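(* Let $1<p<\infty$, and suppose that $f\in H^p$ with $f(0)\neq 0$. If $Q(z)=a(z-w)=q_{1,p}[f](z)$ for some $a,w\in\mathbb{C}$, then, when $1<p<2$, \[ \left(\frac{\|azf-1\|_p^2-\|Qf-1\|_p^2}{K_1\|af\|_p^2}\right)^{1/2} \geq |w| \geq \left(\frac{\|azf-1\|_p^p-\|Qf-1\|_p^p}{K_2\|af\|_p^p}\right)^{1/p}, \] and, when $2<p<\infty$, \[ \left(\frac{\|azf-1\|_p^2-\|Qf-1\|_p^2}{K_2\|af\|_p^2}\right)^{1/2} \leq |w| \leq \left(\frac{\|azf-1\|_p^p-\|Qf-1\|_p^p}{K_1\|af\|_p^p}\right)^{1/p}, \] where $K_1$ and $K_2$ are respectively the lower and upper Pythagorean constants.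
   Context: $H^p$ denotes the classical Hardy space of holomorphic functions on the open unit disk $\mathbb{D}$, with norm $\|f\|_p = \left(\sup_{0\le \rho<1}\frac{1}{2\pi}\int_0^{2\pi}|f(\rho e^{i\theta})|^p\,d\theta\right)^{1/p}$. Here $azf$ denotes the function $z\mapsto azf(z)$. For an integer $n\ge 0$ let $\mathcal{P}_n$ be the set of complex polynomials of degree at most $n$. For $1<p<\infty$ and $f\in H^p$, not identically zero, the $n$-th optimal polynomial approximant (OPA) to $1/f$ in $H^p$, denoted $q_{n,p}[f]$, is the unique polynomial $q\in\mathcal{P}_n$ minimizing $\|1-qf\|_p$ over $\mathcal{P}_n$. The lower and upper Pythagorean constants $K_1$ and $K_2$ are: $K_1=p-1$ and $K_2=\frac{1}{2^{p-1}-1}$ if $1<p<2$; $K_1=\frac{1}{2^{p-1}-1}$ and $K_2=p-1$ if $2<p<\infty$. (They come from the following inequalities, valid whenever $x\perp_p y$ in $L^p$, i.e. $\|x+\beta y\|_p\ge\|x\|_p$ for all scalars $\beta$: for $1<p\le 2$, $\|x+y\|_p^2\ge\|x\|_p^2+K_1\|y\|_p^2$ and $\|x+y\|_p^p\le\|x\|_p^p+K_2\|y\|_p^p$; for $p\ge 2$, $\|x+y\|_p^p\ge\|x\|_p^p+K_1\|y\|_p^p$ and $\|x+y\|_p^2\le\|x\|_p^2+K_2\|y\|_p^2$.) *)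

(* Defs.v *)
From mathcomp Require Import all_boot all_order all_algebra.
From mathcomp Require Import complex.
From mathcomp Require Import all_classical all_reals all_analysis.
Import Order.TTheory GRing.Theory Num.Theory.
Import numFieldNormedType.Exports.
Import ComplexField.

Set Implicit Arguments.
Unset Strict Implicit.
Unset Printing Implicit Defensive.

Local Open Scope classical_set_scope.
Local Open Scope ring_scope.
Local Open Scope complex_scope.

Section Hardy.
Variable R : realType.
Implicit Types (p rho t : R) (f : R[i] -> R[i]) (n : nat) (q r : {poly R[i]}).

(* [derivable] is taken over the scalar field R[i], so this is complex
   differentiability at each point; values of f off the open disk never
   matter. [Normc.normc] is the R-valued modulus ([`|z|] lives in R[i]). *)
Definition holomorphic_disk f : Prop :=
  forall z : R[i], Normc.normc z < 1 ->
    derivable (f : R[i]^o -> R[i]^o) z 1.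

Definition circle_mean p f rho : \bar R :=
  (((2 * pi)^-1)%:E *
   \int[lebesgue_measure]_(t in `[0%R, (2 * pi)%R])
     (Normc.normc (f (rho%:C * (cos t +i* sin t))) `^ p)%R%:E)%E.

(* Extended-real valued, so that membership in H^p is finiteness. *)
Definition hardy_enorm p f : \bar R :=
  poweR (ereal_sup [set circle_mean p f rho | rho in `[0%R, 1%R[]) p^-1.

Definition hardy_norm p f : R := fine (hardy_enorm p f).

Definition Hardy p f : Prop :=
  holomorphic_disk f /\ (hardy_enorm p f < +oo)%E.

(* q minimizes ||1 - r f||_p over the polynomials r of degree at most n
   ([size] is degree plus one). For 1 < p and f in H^p not identically zero
   there is exactly one such q. *)
Definition is_opa n p f q : Prop :=
  (size q <= n.+1)%N /\
  forall r, (size r <= n.+1)%N ->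
    (hardy_enorm p (fun z => 1 - q.[z] * f z)%R
     <= hardy_enorm p (fun z => 1 - r.[z] * f z)%R)%E.

(* The case p = 2, where both constants are 1, falls in the second branch. *)
Definition pyth_lower p : R :=
  if p < 2 then p - 1 else (2 `^ (p - 1) - 1)^-1.

Definition pyth_upper p : R :=
  if p < 2 then (2 `^ (p - 1) - 1)^-1 else p - 1.

End Hardy.

(* Main.v *)
Require Import Defs.
From mathcomp Require Import all_boot all_order all_algebra.
From mathcomp Require Import complex.
From mathcomp Require Import all_classical all_reals all_analysis.
From mathcomp Require Import measurable_realfun.
From mathcomp Require Import ring lra.
Import Order.TTheory GRing.Theory Num.Theory.
Import numFieldNormedType.Exports.
Import ComplexField.

(** Put x = Q f - 1 and y = a w f, so that x + y = a z f - 1.  As Q is optimal,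
    ||x + t y|| >= ||x|| for every t: x is orthogonal to y in the sense of
    Birkhoff and James.  The four bounds are the two Pythagorean inequalities
    for x and y, whose last term is a power of ||y|| = |w| ||a f||, solved
    for |w| (hardy_pythagoras_pow, hardy_pythagoras_sqr).

    The Pythagorean inequalities follow from two parallelogram inequalities:
    Clarkson's,
      ||u + v||^p + ||u - v||^p >= 2 ||u||^p + 2 ||v||^p,
    and that of Ball, Carlen and Lieb,
      ||u + v||^2 + ||u - v||^2 <= 2 ||u||^2 + 2 (p - 1) ||v||^2,
    stated here for p > 2 and reversed for p < 2.  With u = x + t y and
    v = t y they relate the quotient (||x + t y||^e - ||x||^e) / t^e at 2 t to
    its value at t, by an affine recursion whose fixed point is the Pythagorean
    constant times ||y||^e; orthogonality keeps the quotient bounded, so its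
    value at t = 1 lies on the right side of the fixed point (pythagoras_iter).
    The same inequalities make the norm smooth, which gives a <> 0: otherwise
    x = - 1 would be orthogonal to f / f(0), while evaluation at the origin
    gives ||- 1 - t f / f(0)|| >= 1 + t (opa_lead_neq0).

    Both parallelogram inequalities come from inequalities between complex
    numbers that are linear in p-th powers, the second one after a use of
    Hoelder's inequality for two terms.  They can therefore be integrated over
    a circle.  The Hardy norm is a supremum over circles, and a linear
    inequality passes to suprema once these are limits; so the means of |g|^p
    over circles have to increase with the radius (cmean_le).  This is obtained
    from pointwise complex differentiability alone.  Goursat's bisection in
    logarithmic polar coordinates gives the mean value property; a supporting
    line of |c|^p turns it into a sub-mean value inequality; an automorphism of
    the disk moves the centre to any point; and averaging over rotations
    compares the means over two circles. *)

Set Implicit Arguments.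
Unset Strict Implicit.
Unset Printing Implicit Defensive.

Local Open Scope classical_set_scope.
Local Open Scope ring_scope.
Local Open Scope complex_scope.

Import Normc.
Local Notation Re := complex.Re.
Local Notation Im := complex.Im.

(** * Complex differentiability *)

Lemma derivable1_fcomp (K : numFieldType) (f g : K -> K) (z : K) :
  derivable (f : K^o -> K^o) z 1 -> derivable (g : K^o -> K^o) (f z) 1 ->
  derivable ((fun x => g (f x)) : K^o -> K^o) z 1.
Proof.
move=> /derivable1_diffP df /derivable1_diffP dg; apply/derivable1_diffP.
exact: (@differentiable_comp _ K^o K^o K^o f g).
Qed.

Section Complex.
Variable R : realType.
Implicit Types (x y z w : R[i]) (s t : R).

Lemma normrE_normc z : `|z| = (normc z)%:C.
Proof. by case: z. Qed.

Lemma ler_normcD z w : normc (z + w) <= normc z + normc w.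
Proof. exact: le_normcD. Qed.

Lemma normc_opp z : normc (- z) = normc z.
Proof. exact: normcN. Qed.

Lemma normc_ge0 z : 0 <= normc z.
Proof. by rewrite -lecR -normrE_normc normr_ge0. Qed.

Lemma normc_eq0 z : (normc z == 0) = (z == 0).
Proof. by apply/eqP/eqP => [/eq0_normc|->]; rewrite ?normc0. Qed.

Lemma normc_gt0 z : (0 < normc z) = (z != 0).
Proof. by rewrite lt_def normc_ge0 andbT normc_eq0. Qed.

Lemma normcBC z w : normc (z - w) = normc (w - z).
Proof. by rewrite -normc_opp opprB. Qed.

Lemma ler_normcB z w : `|normc z - normc w| <= normc (z - w).
Proof.
rewrite ler_norml; apply/andP; split.
  rewrite lerNl opprB lerBlDl -{1}(subrK z w).
  by rewrite (le_trans (ler_normcD _ _))// normcBC addrC.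
by rewrite lerBlDl -{1}(subrK w z) (le_trans (ler_normcD _ _))// addrC.
Qed.

Lemma normc_sqr z : normc z ^+ 2 = Re z ^+ 2 + Im z ^+ 2.
Proof. by case: z => a b; rewrite /= sqr_sqrtr// addr_ge0// sqr_ge0. Qed.

Lemma normr_Re z : `|Re z| <= normc z.
Proof.
by rewrite -(@ler_pXn2r _ 2%N) ?nnegrE ?normr_ge0 ?normc_ge0// normc_sqr
  real_normK ?num_real// lerDl sqr_ge0.
Qed.

Lemma normr_Im z : `|Im z| <= normc z.
Proof.
by rewrite -(@ler_pXn2r _ 2%N) ?nnegrE ?normr_ge0 ?normc_ge0// normc_sqr
  real_normK ?num_real// lerDr sqr_ge0.
Qed.

Lemma normc_le_ReIm z : normc z <= `|Re z| + `|Im z|.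
Proof.
rewrite -(@ler_pXn2r _ 2%N) ?nnegrE ?normc_ge0 ?addr_ge0// normc_sqr.
rewrite sqrrD !real_normK ?num_real// lerD2r lerDl.
by rewrite mulrn_wge0// mulr_ge0.
Qed.

Lemma normc_real t : normc t%:C = `|t|.
Proof. by rewrite /= expr0n addr0 sqrtr_sqr. Qed.

Lemma ReM z w : Re (z * w) = Re z * Re w - Im z * Im w.
Proof. by case: z w => [a b] [c d]. Qed.
Lemma ImM z w : Im (z * w) = Re z * Im w + Im z * Re w.
Proof. by case: z w => [a b] [c d]. Qed.
Lemma ReD z w : Re (z + w) = Re z + Re w.
Proof. by case: z w => [a b] [c d]. Qed.
Lemma ImD z w : Im (z + w) = Im z + Im w.
Proof. by case: z w => [a b] [c d]. Qed.
Lemma ReN z : Re (- z) = - Re z.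
Proof. by case: z. Qed.
Lemma ImN z : Im (- z) = - Im z.
Proof. by case: z. Qed.

Definition cis t : R[i] := cos t +i* sin t.

Lemma normc_cis t : normc (cis t) = 1.
Proof. by rewrite /= cos2Dsin2 sqrtr1. Qed.

Lemma cisD s t : cis (s + t) = cis s * cis t.
Proof.
by apply/eqP; rewrite eq_complex ReM ImM/= cosD sinD addrC eqxx/= addrC eqxx.
Qed.

Lemma cis0 : cis 0 = 1.
Proof. by rewrite /cis cos0 sin0. Qed.

Lemma cis2pi : cis (2 * pi) = 1.
Proof. by rewrite /cis mulr_natl cos2pi sin2pi. Qed.

Definition cexp z : R[i] := (expR (Re z))%:C * cis (Im z).

Lemma cexpD z w : cexp (z + w) = cexp z * cexp w.
Proof.
by rewrite /cexp ReD ImD expRD cisD rmorphM/= mulrACA.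
Qed.

Lemma normc_cexp z : normc (cexp z) = expR (Re z).
Proof. by rewrite normcM normc_cis mulr1 normc_real ger0_norm// expR_ge0. Qed.

Definition hol_at (f : R[i] -> R[i]) z := derivable (f : R[i]^o -> R[i]^o) z 1.

Lemma hol_at_cst c z : hol_at (fun=> c) z.
Proof. exact: derivable_cst. Qed.

Lemma hol_at_id z : hol_at id z.
Proof. exact: derivable_id. Qed.

Lemma hol_atD f g z : hol_at f z -> hol_at g z -> hol_at (fun x => f x + g x) z.
Proof. exact: derivableD. Qed.

Lemma hol_atB f g z : hol_at f z -> hol_at g z -> hol_at (fun x => f x - g x) z.
Proof. exact: derivableB. Qed.

Lemma hol_atM f g z : hol_at f z -> hol_at g z -> hol_at (fun x => f x * g x) z.
Proof. exact: derivableM. Qed.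

Lemma hol_atV f z : f z != 0 -> hol_at f z -> hol_at (fun x => (f x)^-1) z.
Proof. exact: derivableV. Qed.

Lemma hol_at_comp f g z : hol_at f z -> hol_at g (f z) ->
  hol_at (fun x => g (f x)) z.
Proof. exact: derivable1_fcomp. Qed.

Lemma hol_atP f z : hol_at f z -> exists L, forall e : R, 0 < e ->
  exists2 d : R, 0 < d & forall h, normc h < d ->
    normc (f (z + h) - f z - L * h) <= e * normc h.
Proof.
move=> df; exists ('D_1 (f : R[i]^o -> R[i]^o) z) => e e0.
have e0' : 0 < e%:C :> R[i] by rewrite ltcR.
have /cvgrPdist_le/(_ _ e0')/nbhs_ballP[d /= d0 dP] := df.
have dE : d = (complex.Re d)%:C by rewrite RRe_real// gtr0_real.
exists (complex.Re d) => [|h hd]; first by rewrite -ltcR -dE.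
have [->|h0] := eqVneq h 0.
  by rewrite addr0 subrr mulr0 subr0 normc0 mulr0.
have := dP h; rewrite /ball/= sub0r normrN => /(_ _ h0).
rewrite dE normrE_normc ltcR => /(_ hd).
rewrite [h%:A]mulr1 -/(derive _ _ _) => hP.
have -> : f (z + h) - f z - 'D_1 (f : R[i]^o -> R[i]^o) z * h =
   - (('D_1 (f : R[i]^o -> R[i]^o) z - h^-1 * (f (h + z) - f z)) * h).
  by rewrite mulrBl mulrAC mulVf// mul1r opprB (addrC z).
rewrite normc_opp normcM ler_wpM2r ?normc_ge0//.
by rewrite -lecR -normrE_normc.
Qed.

Lemma hol_at_eps (f : R[i] -> R[i]) z (L : R[i]) : (forall e : R, 0 < e ->
  exists2 d : R, 0 < d & forall h, normc h < d ->
    normc (f (z + h) - f z - L * h) <= e * normc h) -> hol_at f z.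
Proof.
move=> H; apply/cvg_ex; exists L; apply/cvgrPdist_le => e e0.
have eE : e = (complex.Re e)%:C by rewrite RRe_real// gtr0_real.
have [|d d0 dP] := H (complex.Re e); first by rewrite -ltcR -eE.
apply/nbhs_ballP; exists d%:C => /=; first by rewrite ltcR.
move=> h; rewrite /ball/= sub0r normrN normrE_normc ltcR => hd h0.
rewrite [h%:A]mulr1.
have := dP _ hd; have n0 : 0 < normc h by rewrite normc_gt0.
rewrite -ler_pdivrMr// -normcV -normcM -lecR -eE -normrE_normc.
rewrite mulrBl mulfK//.
rewrite (addrC h) -[_ *: _]/(_ * _) [h^-1 * _]mulrC. by rewrite distrC.
Qed.

Lemma is_derive_eps (f : R -> R) (x l : R) : is_derive x 1 f l ->
  forall e : R, 0 < e -> exists2 d : R, 0 < d & forall h, `|h| < d ->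
    `|f (x + h) - f x - l * h| <= e * `|h|.
Proof.
move=> [df <-] e e0.
have /cvgrPdist_le/(_ _ e0)/nbhs_ballP[d /= d0 dP] := df.
exists d => // h hd.
have [->|h0] := eqVneq h 0.
  by rewrite addr0 subrr mulr0 subr0 normr0 mulr0.
have := dP h; rewrite /ball/= sub0r normrN => /(_ hd h0).
rewrite [h%:A]mulr1 -/(derive _ _ _) => hP.
have -> : f (x + h) - f x - 'D_1 f x * h =
   - (('D_1 f x - h^-1 * (f (h + x) - f x)) * h).
  by rewrite mulrBl mulrAC mulVf// mul1r opprB (addrC x).
by rewrite normrN normrM ler_wpM2r.
Qed.

(** By multiplicativity it is enough to expand cexp at the origin, where the
    remainder is a combination of those of the real functions expR, cos and
    sin. *)
Lemma hol_at_cexp z : hol_at cexp z.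
Proof.
suff H : forall e : R, 0 < e -> exists2 d : R, 0 < d & forall h,
    normc h < d -> normc (cexp h - 1 - h) <= e * normc h.
  apply: (@hol_at_eps _ _ (cexp z)) => e e0.
  have [|d d0 dP] := H (e / normc (cexp z)).
    by rewrite divr_gt0// normc_cexp expR_gt0.
  exists d => // h /dP.
  rewrite mulrAC ler_pdivlMr; last by rewrite normc_cexp expR_gt0.
  rewrite -normcM cexpD; congr (normc _ <= _).
  by ring.
move=> e e0.
(* The real and imaginary parts of the remainder are bounded by 3 and 5 times
   e1 |h|. *)
pose e1 := Num.min (e / 8) 1.
have e10 : 0 < e1 by rewrite lt_min ltr01 andbT divr_gt0.
have e1e : 8 * e1 <= e by rewrite mulrC -ler_pdivlMr// ge_min lexx.
have e11 : e1 <= 1 by rewrite ge_min lexx orbT.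
clearbody e1.
have [d1 d10 H1] := is_derive_eps (is_derive_expR 0) e10.
have [d2 d20 H2] := is_derive_eps (is_derive_cos 0) e10.
have [d3 d30 H3] := is_derive_eps (is_derive_sin 0) e10.
exists (Num.min e1 (Num.min d1 (Num.min d2 d3))) => [|h].
  by rewrite !lt_min e10 d10 d20 d30.
rewrite !lt_min => /and4P[h0 h1 h2 h3].
set n := normc h in h0 h1 h2 h3 *.
have n0 : 0 <= n by exact: normc_ge0.
set x := Re h; set y := Im h.
have xn : `|x| <= n by exact: normr_Re.
have yn : `|y| <= n by exact: normr_Im.
have := H1 _ (le_lt_trans xn h1).
have := H2 _ (le_lt_trans yn h2).
have := H3 _ (le_lt_trans yn h3).
rewrite !add0r sin0 cos0 expR0 oppr0 !(addr0, subr0, mul1r, mul0r) => S C E.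
have cy : `|cos y| <= 1 by exact: cos_max.
rewrite (le_trans (normc_le_ReIm _))//.
rewrite !ReD !ReN !ImD !ImN /cexp ReM ImM /= -/x -/y !(mul0r, subr0, addr0).
have e1n : e1 * n <= n by rewrite ler_piMl.
have Ca : `|cos y - 1| <= e1 * n by rewrite (le_trans C)// ler_pM2l.
have Sa : `|sin y - y| <= e1 * n by rewrite (le_trans S)// ler_pM2l.
have Ea : `|expR x - 1 - x| <= e1 * n by rewrite (le_trans E)// ler_pM2l.
have -> : expR x * cos y - 1 - x =
  (expR x - 1 - x) * cos y + (1 + x) * (cos y - 1) by ring.
have -> : expR x * sin y - y = (expR x - 1) * sin y + (sin y - y) by ring.
have b1 : `|(expR x - 1 - x) * cos y| <= e1 * n.
  by rewrite normrM -[leRHS]mulr1 ler_pM.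
have b2 : `|(1 + x) * (cos y - 1)| <= 2 * (e1 * n).
  rewrite normrM ler_pM// (le_trans (ler_normD _ _))// normr1.
  by lra.
have b3 : `|(expR x - 1) * sin y| <= 4 * (e1 * n).
  have -> : 4 * (e1 * n) = (2 * e1) * (2 * n) by ring.
  rewrite normrM ler_pM//.
    rewrite -(subrK x (expR x - 1)) (le_trans (ler_normD _ _))//; lra.
  rewrite -(subrK y (sin y)) (le_trans (ler_normD _ _))//; lra.
have := ler_normD ((expR x - 1 - x) * cos y) ((1 + x) * (cos y - 1)).
have := ler_normD ((expR x - 1) * sin y) (sin y - y).
have : 8 * (e1 * n) <= e * n by rewrite mulrA ler_wpM2r.
lra.
Qed.

End Complex.

(** * Additive functions of rectangles *)

Section Bisection.
Variable R : realType.
Implicit Types s t a b d e : R.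

Lemma nested_intervals (u v : nat -> R) :
  (forall n, u n <= u n.+1) -> (forall n, v n.+1 <= v n) ->
  (forall n, u n <= v n) -> exists x, forall n, u n <= x <= v n.
Proof.
move=> iu dv uv.
have mu : {homo u : m n / (m <= n)%N >-> m <= n} by apply: homo_leq => //; exact: le_trans.
have mv : {homo v : m n / (m <= n)%N >-> n <= m}.
  by apply: homo_leq => // y x z xy yz; exact: le_trans yz xy.
have uvmn m n : u m <= v n.
  have [mn|/ltnW nm] := leqP m n; first exact: le_trans (mu _ _ mn) (uv n).
  exact: le_trans (uv m) (mv _ _ nm).
exists (sup (range u)) => n; apply/andP; split.
  apply: ub_le_sup; last by exists n.
  by exists (v n) => _ [m _ <-].
by apply: ge_sup => [|_ [m _ <-]//]; exists (u 0%N), 0%N.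
Qed.

Lemma small_dyadic a e : 0 < e -> exists n, a / 2 ^+ n <= e.
Proof.
move=> e0; exists (Num.truncn (`|a| / e)).+1.
set n := (Num.truncn _).+1; rewrite ler_pdivrMr ?exprn_gt0// -ler_pdivrMl//.
have h1 : `|a| / e <= n%:R by rewrite /n ltW// truncnS_gt.
have h2 : n%:R <= 2 ^+ n :> R by rewrite -natrX ler_nat ltnW// ltn_expl.
rewrite mulrC (le_trans _ h2)// (le_trans _ h1)// ler_wpM2r ?invr_ge0 ?ler_norm//.
exact: ltW.
Qed.

Definition subrect s0 t0 a b s t d e : Prop :=
  [/\ 0 <= d, 0 <= e, s0 <= s & t0 <= t] /\ s + d <= s0 + a /\ t + e <= t0 + b.

(** Goursat's argument for an additive function of rectangles: one of the four
    quarters of a rectangle carries at least a quarter of |F|.  The rectangles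
    chosen in this way shrink to a point, near which |F| is small compared with
    the square of the side length; hence F vanishes. *)
Lemma rect_bisection (F : R -> R -> R -> R -> R) s0 t0 a b :
  0 <= a -> 0 <= b ->
  (forall s t d e, subrect s0 t0 a b s t d e -> F s t d e =
     F s t (d / 2) (e / 2) + F (s + d / 2) t (d / 2) (e / 2) +
     F s (t + e / 2) (d / 2) (e / 2) +
     F (s + d / 2) (t + e / 2) (d / 2) (e / 2)) ->
  (forall x y, s0 <= x <= s0 + a -> t0 <= y <= t0 + b ->
    forall eps : R, 0 < eps -> exists2 eta, 0 < eta &
    forall s t d e, subrect s0 t0 a b s t d e ->
      s <= x <= s + d -> t <= y <= t + e -> d < eta -> e < eta ->
      `|F s t d e| <= eps * (d + e) ^+ 2) ->
  F s0 t0 a b = 0.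
Proof.
move=> a0 b0 addF smallF.
pose best (q : R * R) d e (r : R * R) :=
  `|F q.1 q.2 d e| <= 4 * `|F r.1 r.2 (d / 2) (e / 2)|.
pose quad (q r : R * R) d e :=
  (r.1 = q.1 \/ r.1 = q.1 + d / 2) /\ (r.2 = q.2 \/ r.2 = q.2 + e / 2).
have step q d e : exists r, subrect s0 t0 a b q.1 q.2 d e ->
    quad q r d e /\ best q d e r.
  have [sr|] := pselect (subrect s0 t0 a b q.1 q.2 d e); last by exists q.
  have := addF _ _ _ _ sr.
  set F1 := F _ _ (d / 2) _; set F2 := F _ _ (d / 2) _.
  set F3 := F _ _ (d / 2) _; set F4 := F _ _ (d / 2) _ => E.
  have tri : `|F q.1 q.2 d e| <= `|F1| + `|F2| + `|F3| + `|F4|.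
    rewrite E (le_trans (ler_normD _ _))// lerD2r.
    by rewrite (le_trans (ler_normD _ _))// lerD2r ler_normD.
  have [B1|B1] := boolP (best q d e q).
    by exists q => _; split => //; split; left.
  have [B2|B2] := boolP (best q d e (q.1 + d / 2, q.2)).
    by exists (q.1 + d / 2, q.2) => _; split => //; split; [right|left].
  have [B3|B3] := boolP (best q d e (q.1, q.2 + e / 2)).
    by exists (q.1, q.2 + e / 2) => _; split => //; split; [left|right].
  exists (q.1 + d / 2, q.2 + e / 2) => _; split; first by split; right.
  move: B1 B2 B3; rewrite /best/= -/F1 -/F2 -/F3 -/F4 -!ltNge; lra.
have /choice[nx nxP] : forall p : (R * R) * (R * R), exists r,
    subrect s0 t0 a b p.1.1 p.1.2 p.2.1 p.2.2 ->
    quad p.1 r p.2.1 p.2.2 /\ best p.1 p.2.1 p.2.2 r.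
  by move=> p; exact: step.
pose dn n := a / 2 ^+ n; pose en n := b / 2 ^+ n.
pose fix q n : R * R :=
  if n is m.+1 then nx (q m, (dn m, en m)) else (s0, t0).
have dnS n : dn n.+1 = dn n / 2 by rewrite /dn exprSr invfM mulrA.
have enS n : en n.+1 = en n / 2 by rewrite /en exprSr invfM mulrA.
have dn0 n : 0 <= dn n by rewrite divr_ge0// exprn_ge0.
have en0 n : 0 <= en n by rewrite divr_ge0// exprn_ge0.
have sub n : subrect s0 t0 a b (q n).1 (q n).2 (dn n) (en n).
  elim: n => [|n IH].
    by rewrite /= /dn /en expr0 !divr1; do !split => //.
  have [/= + _] := nxP (q n, (dn n, en n)) IH.
  rewrite -[nx _]/(q n.+1) => -[Hs Ht].
  have [[d0 e0 sn tn] [sd te]] := IH.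
  have Dn : 0 <= dn n by []. have En : 0 <= en n by [].
  rewrite dnS enS; split; [split|split]; try lra.
have qd n : quad (q n) (q n.+1) (dn n) (en n).
  by have [] := nxP (q n, (dn n, en n)) (sub n).
have qb n : best (q n) (dn n) (en n) (q n.+1).
  by have [] := nxP (q n, (dn n, en n)) (sub n).
have Fn n : `|F s0 t0 a b| <= 4 ^+ n * `|F (q n).1 (q n).2 (dn n) (en n)|.
  elim: n => [|n IH]; first by rewrite expr0 mul1r /dn /en expr0 !divr1.
  rewrite (le_trans IH)// exprSr -mulrA ler_wpM2l ?exprn_ge0//.
  by rewrite dnS enS; exact: qb.
have [x xP] : exists x, forall n, (q n).1 <= x <= (q n).1 + dn n.
  apply: nested_intervals => n; rewrite ?dnS; move: (dn0 n) (qd n).1; lra.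
have [y yP] : exists y, forall n, (q n).2 <= y <= (q n).2 + en n.
  apply: nested_intervals => n; rewrite ?enS; move: (en0 n) (qd n).2; lra.
apply/eqP; rewrite -normr_le0; apply/ler_addgt0Pr => eps eps0; rewrite add0r.
have eps1 : 0 < eps / (1 + (a + b) ^+ 2).
  by rewrite divr_gt0// ltr_pwDl// sqr_ge0.
have := xP 0%N; rewrite /= /dn expr0 divr1 => x0.
have := yP 0%N; rewrite /= /en expr0 divr1 => y0.
have [eta eta0 etaP] := smallF x y x0 y0 _ eps1.
have [|n nP] := @small_dyadic (a + b) (eta / 2); first by rewrite divr_gt0.
have dea : dn n + en n = (a + b) / 2 ^+ n by rewrite /dn /en mulrDl.
have dn1 := dn0 n; have en1 := en0 n.
have := etaP _ _ _ _ (sub n) (xP n) (yP n).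
rewrite -dea in nP.
have -> : dn n < eta by lra.
have -> : en n < eta by lra.
move=> /(_ isT isT) H.
rewrite (le_trans (Fn n))//.
rewrite -ler_pdivlMl ?exprn_gt0// (le_trans H)//.
have c0 : 0 < 1 + (a + b) ^+ 2 by rewrite ltr_pwDl ?sqr_ge0.
have -> : 4 ^+ n = (2 ^+ n) ^+ 2 :> R.
  by rewrite -exprM mulnC exprM; congr (_ ^+ _); ring.
have n0 : 0 < 2 ^+ n :> R by rewrite exprn_gt0.
have -> : eps / (1 + (a + b) ^+ 2) * (dn n + en n) ^+ 2 =
    ((2 ^+ n) ^+ 2)^-1 * (eps * ((a + b) ^+ 2 / (1 + (a + b) ^+ 2))).
  by rewrite dea; field; rewrite !gt_eqF.
rewrite ler_pM2l ?invr_gt0 ?exprn_gt0// ler_piMr ?(ltW eps0)//.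
by rewrite ler_pdivrMr// mul1r lerDr.
Qed.

End Bisection.

(** * Continuity along curves and integrals over segments *)

Section Continuity.
Variable R : realType.
Implicit Types (g : R -> R[i]) (f : R[i] -> R[i]) (t : R).

Definition ccontinuous g t := forall e : R, 0 < e ->
  \forall x \near t, normc (g x - g t) < e.

Lemma ccontinuous_Re g t : ccontinuous g t -> {for t, continuous (fun x => Re (g x))}.
Proof.
move=> cg; apply/cvgrPdist_lt => e e0 /=; near=> x.
rewrite -ReN -ReD (le_lt_trans (normr_Re _))// normcBC.
by near: x; exact: cg.
Unshelve. all: by end_near. Qed.

Lemma ccontinuous_Im g t : ccontinuous g t -> {for t, continuous (fun x => Im (g x))}.
Proof.
move=> cg; apply/cvgrPdist_lt => e e0 /=; near=> x.
rewrite -ImN -ImD (le_lt_trans (normr_Im _))// normcBC.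
by near: x; exact: cg.
Unshelve. all: by end_near. Qed.

Lemma ccontinuous_normc g t : ccontinuous g t -> {for t, continuous (fun x => normc (g x))}.
Proof.
move=> cg; apply/cvgrPdist_lt => e e0 /=; near=> x.
rewrite (le_lt_trans (ler_normcB _ _))// normcBC.
by near: x; exact: cg.
Unshelve. all: by end_near. Qed.

Lemma ccontinuous_Complex (u v : R -> R) t : {for t, continuous u} ->
  {for t, continuous v} -> ccontinuous (fun x => u x +i* v x) t.
Proof.
move=> /cvgrPdist_lt cu /cvgrPdist_lt cv e e0; near=> x.
rewrite (le_lt_trans (normc_le_ReIm _))//= [e]splitr ltrD// distrC.
- by near: x; apply: cu; rewrite divr_gt0.
- by near: x; apply: cv; rewrite divr_gt0.
Unshelve. all: by end_near. Qed.

Lemma hol_at_cont f z : hol_at f z -> forall e : R, 0 < e ->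
  exists2 d : R, 0 < d & forall h, normc h < d -> normc (f (z + h) - f z) < e.
Proof.
move=> /hol_atP[L LP] e e0.
have [d d0 dP] := LP 1 ltr01.
have L0 : 0 < 1 + normc L by rewrite ltr_pwDl ?normc_ge0.
exists (Num.min d (e / (1 + normc L))) => [|h].
  by rewrite lt_min d0 divr_gt0.
rewrite lt_min => /andP[hd he].
rewrite -(subrK (L * h) (f (z + h) - f z)) (le_lt_trans (ler_normcD _ _))//.
rewrite ltr_pdivlMr// mulrDr mulr1 in he.
rewrite (le_lt_trans _ he)// lerD//; first by rewrite -[leRHS]mul1r; exact: dP.
by rewrite normcM mulrC.
Qed.

Lemma ccontinuous_hol f g t : ccontinuous g t -> hol_at f (g t) ->
  ccontinuous (fun x => f (g x)) t.
Proof.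
move=> cg /hol_at_cont fh e /fh[d d0 dP].
near=> x; have := dP (g x - g t); rewrite (addrC (g t)) subrK; apply.
by near: x; exact: cg.
Unshelve. all: by end_near. Qed.

Lemma ccontinuous_cis t : ccontinuous (@cis R) t.
Proof. by apply: ccontinuous_Complex; [exact: continuous_cos|exact: continuous_sin]. Qed.

End Continuity.

Section IntervalIntegral.
Variable R : realType.
Implicit Types (f g : R -> R) (a b c : R).

Definition segint a b f : R := \int[lebesgue_measure]_(x in `[a, b]) f x.

Definition cont_on a b f := forall x, a <= x <= b -> {for x, continuous f}.

Lemma cont_onB a b f g : cont_on a b f -> cont_on a b g ->
  cont_on a b (fun x => f x - g x).
Proof. by move=> cf cg x xab; apply: cvgB; [exact: cf|exact: cg]. Qed.

Lemma cont_on_integrable a b f : cont_on a b f ->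
  lebesgue_measure.-integrable `[a, b] (EFin \o f).
Proof.
move=> cf; apply: continuous_compact_integrable; first exact: segment_compact.
by apply: continuous_in_subspaceT => x /[!inE]/=; rewrite in_itv/=; exact: cf.
Qed.

Lemma segintB a b f g : cont_on a b f -> cont_on a b g ->
  segint a b (fun x => f x - g x) = segint a b f - segint a b g.
Proof. by move=> cf cg; apply: RintegralB => //; exact: cont_on_integrable. Qed.

Lemma segint_split a b c f : a <= c -> c <= b -> cont_on a b f ->
  segint a b f = segint a c f + segint c b f.
Proof.
move=> ac cb cf; rewrite -(subrK (segint a c f) (segint a b f)) addrC; congr (_ + _).
rewrite /segint (@Rintegral_itvB _ f (BLeft a) (BRight b) c (cont_on_integrable cf))
  ?bnd_simp//.
apply: Rintegral_itv_obnd_cbnd.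
apply: integrableS (cont_on_integrable cf) => //.
by apply: subset_itv; rewrite bnd_simp.
Qed.

Lemma segint_cst a b r : a <= b -> segint a b (fun=> r) = r * (b - a).
Proof.
move=> ab; rewrite /segint Rintegral_cst//= lebesgue_measure_itv/=.
by rewrite lte_fin; have [|] := ltP => //= ba; rewrite (@le_anti _ _ b a) ?subrr// ba.
Qed.

Lemma segint_le a b f g : cont_on a b f -> cont_on a b g ->
  (forall x, a <= x <= b -> f x <= g x) -> segint a b f <= segint a b g.
Proof.
move=> cf cg fg; apply: le_Rintegral => //.
- exact: cont_on_integrable.
- exact: cont_on_integrable.
Qed.

Lemma segint_dist a b f r m : a <= b -> cont_on a b f ->
  (forall x, a <= x <= b -> `|f x - r| <= m) ->
  `|segint a b f - r * (b - a)| <= m * (b - a).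
Proof.
move=> ab cf H.
have cc k : cont_on a b (fun=> k) by move=> x _; exact: cvg_cst.
have H1 : segint a b (fun=> r - m) <= segint a b f.
  by apply: segint_le => // x /H; rewrite ler_distl => /andP[].
have H2 : segint a b f <= segint a b (fun=> r + m).
  by apply: segint_le => // x /H; rewrite ler_distl => /andP[].
rewrite !segint_cst// in H1 H2.
rewrite ler_norml; lra.
Qed.

End IntervalIntegral.

(** * Goursat's theorem and the mean value property *)

Section Goursat.
Variable R : realType.
Implicit Types (H : R[i] -> R[i]) (s t d e : R).

(** The imaginary part of the integral of H along the boundary of the rectangle
    [s, s + d] x [t, t + e]. *)
Definition Im_boundary_integral H s t d e : R :=
  (segint t (t + e) (fun y => Re (H ((s + d) +i* y))) -
   segint t (t + e) (fun y => Re (H (s +i* y)))) -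
  (segint s (s + d) (fun x => Im (H (x +i* (t + e)))) -
   segint s (s + d) (fun x => Im (H (x +i* t)))).

Lemma hol_vert_cont H s t e :
  (forall y, t <= y <= t + e -> hol_at H (s +i* y)) ->
  cont_on t (t + e) (fun y => Re (H (s +i* y))).
Proof.
move=> hH y yt; apply: (@ccontinuous_Re _ (fun y => H (s +i* y))).
apply: ccontinuous_hol; last exact: hH.
by apply: ccontinuous_Complex; [exact: cvg_cst|exact: cvg_id].
Qed.

Lemma hol_horiz_cont H s t d :
  (forall x, s <= x <= s + d -> hol_at H (x +i* t)) ->
  cont_on s (s + d) (fun x => Im (H (x +i* t))).
Proof.
move=> hH x xs; apply: (@ccontinuous_Im _ (fun x => H (x +i* t))).
apply: ccontinuous_hol; last exact: hH.
by apply: ccontinuous_Complex; [exact: cvg_id|exact: cvg_cst].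
Qed.

(** Near a point H is affine up to a remainder o(|h|), and the boundary integral
    of an affine function is zero. *)
Lemma goursat H s0 t0 a b : 0 <= a -> 0 <= b ->
  (forall x y, s0 <= x <= s0 + a -> t0 <= y <= t0 + b -> hol_at H (x +i* y)) ->
  Im_boundary_integral H s0 t0 a b = 0.
Proof.
move=> a0 b0 hH.
have cv s t d e c : subrect s0 t0 a b s t d e -> s <= c <= s + d ->
    cont_on t (t + e) (fun y => Re (H (c +i* y))).
  move=> [[d0 e0 ss tt] [sd te]] cs; apply: hol_vert_cont => y yt.
  by apply: hH; lra.
have ch s t d e c : subrect s0 t0 a b s t d e -> t <= c <= t + e ->
    cont_on s (s + d) (fun x => Im (H (x +i* c))).
  move=> [[d0 e0 ss tt] [sd te]] cs; apply: hol_horiz_cont => y yt.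
  by apply: hH; lra.
apply: rect_bisection a0 b0 _ _ => [s t d e sub|x y xa yb eps eps0].
  have [[d0 e0 _ _] _] := sub.
  have sv c : s <= c <= s + d -> segint t (t + e) (fun y => Re (H (c +i* y))) =
      segint t (t + e / 2) (fun y => Re (H (c +i* y))) +
      segint (t + e / 2) (t + e) (fun y => Re (H (c +i* y))).
    by move=> cs; apply: segint_split (cv _ _ _ _ _ sub cs); lra.
  have sh c : t <= c <= t + e -> segint s (s + d) (fun x => Im (H (x +i* c))) =
      segint s (s + d / 2) (fun x => Im (H (x +i* c))) +
      segint (s + d / 2) (s + d) (fun x => Im (H (x +i* c))).
    by move=> cs; apply: segint_split (ch _ _ _ _ _ sub cs); lra.
  have De : d / 2 + d / 2 = d by lra.
  have Ee : e / 2 + e / 2 = e by lra.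
  rewrite /Im_boundary_integral -!addrA De Ee !addrA.
  rewrite (sv s) ?(sv (s + d)) ?(sh t) ?(sh (t + e)); try lra.
have [L LP] := hol_atP (hH _ _ xa yb).
have eps2 : 0 < eps / 2 by rewrite divr_gt0.
have [eta eta0 etaP] := LP _ eps2.
(* A point of a rectangle with sides less than eta / 2 is within eta of any
   other one. *)
exists (eta / 2) => [|s t d e sub xs yt dn en]; first by rewrite divr_gt0.
have [[d0 e0 _ _] _] := sub.
have app u v : s <= u <= s + d -> t <= v <= t + e ->
    normc (H (u +i* v) - H (x +i* y) - L * ((u - x) +i* (v - y))) <=
      eps / 2 * (d + e).
  move=> us vt.
  have nh : normc ((u - x) +i* (v - y)) <= d + e.
    rewrite (le_trans (normc_le_ReIm _))//=.
    have : `|u - x| <= d by rewrite ler_norml; lra.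
    have : `|v - y| <= e by rewrite ler_norml; lra.
    lra.
  have := etaP ((u - x) +i* (v - y)).
  have -> : (x +i* y) + ((u - x) +i* (v - y)) = u +i* v :> R[i].
    by apply/eqP; rewrite eq_complex/= !(addrC _ (_ - _)) !subrK !eqxx.
  move=> /(_ _)/le_trans; apply; first by rewrite (le_lt_trans nh)//; lra.
  by rewrite ler_pM2l.
have appR u v : s <= u <= s + d -> t <= v <= t + e ->
    `|Re (H (u +i* v)) - Re (H (x +i* y)) - (Re L * (u - x) - Im L * (v - y))|
      <= eps / 2 * (d + e).
  move=> us vt; have := le_trans (normr_Re _) (app _ _ us vt).
  by rewrite !(ReD, ReN, ReM).
have appI u v : s <= u <= s + d -> t <= v <= t + e ->
    `|Im (H (u +i* v)) - Im (H (x +i* y)) - (Re L * (v - y) + Im L * (u - x))|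
      <= eps / 2 * (d + e).
  move=> us vt; have := le_trans (normr_Im _) (app _ _ us vt).
  by rewrite !(ImD, ImN, ImM).
have sl : s <= s <= s + d by lra.
have sr : s <= s + d <= s + d by lra.
have tl : t <= t <= t + e by lra.
have tr : t <= t + e <= t + e by lra.
have I1 := @segint_dist _ t (t + e) (fun v => Re (H ((s + d) +i* v)) -
    Re (H (s +i* v))) (Re L * d) (eps * (d + e)).
have I2 := @segint_dist _ s (s + d) (fun u => Im (H (u +i* (t + e))) -
    Im (H (u +i* t))) (Re L * e) (eps * (d + e)).
rewrite segintB in I1; [|exact: (cv _ _ _ _ _ sub)..].
rewrite segintB in I2; [|exact: (ch _ _ _ _ _ sub)..].
have E1 : t + e - t = e by ring.
have E2 : s + d - s = d by ring.
rewrite E1 in I1; rewrite E2 in I2.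
have tte : t <= t + e by lra.
have ssd : s <= s + d by lra.
have {}I1 := I1 tte (cont_onB (cv _ _ _ _ _ sub sr) (cv _ _ _ _ _ sub sl)).
have {}I2 := I2 ssd (cont_onB (ch _ _ _ _ _ sub tr) (ch _ _ _ _ _ sub tl)).
have {}I1 := I1 (fun v vt => ltac:(
  move: (appR _ _ sl vt) (appR _ _ sr vt); rewrite !ler_norml; lra)).
have {}I2 := I2 (fun v vt => ltac:(
  move: (appI _ _ vt tl) (appI _ _ vt tr); rewrite !ler_norml; lra)).
move: I1 I2; rewrite /Im_boundary_integral !ler_norml; lra.
Qed.

(** In the coordinate log z the punctured disk becomes a half-plane on which
    the composite of k and cexp has period 2 pi i.  The horizontal sides cancel
    in Goursat's theorem, so the mean of Re k over the circle of radius e^(- n)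
    does not depend on n; it tends to Re (k 0). *)
Lemma mean_value (k : R[i] -> R[i]) :
  (forall z, normc z <= 1 -> hol_at k z) ->
  segint 0 (2 * pi) (fun t => Re (k (cis t))) = Re (k 0) * (2 * pi).
Proof.
move=> hk.
have pi0 : 0 <= 2 * pi :> R by rewrite mulr_ge0// pi_ge0.
have ec s t : cexp (s +i* t) = (expR s)%:C * cis t by [].
have key n : segint 0 (2 * pi) (fun t => Re (k (cis t))) =
    segint 0 (2 * pi) (fun t => Re (k ((expR (- n%:R))%:C * cis t))).
  have n0 : 0 <= n%:R :> R by [].
  have := @goursat (fun z => k (cexp z)) (- n%:R) 0 n%:R (2 * pi) n0 pi0.
  rewrite /Im_boundary_integral add0r addNr.
  have per x : cexp (x +i* (2 * pi)) = cexp (x +i* 0) :> R[i].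
    by rewrite !ec cis2pi cis0.
  have -> : (fun x => Im (k (cexp (x +i* (2 * pi))))) =
            (fun x => Im (k (cexp (x +i* 0)))).
    by apply/funext => x; rewrite per.
  rewrite subrr subr0 => H.
  have {}H := subr0_eq (H _).
  rewrite (_ : (fun t => Re (k (cis t))) =
     (fun t => Re (k (cexp (0 +i* t))))); last first.
    by apply/funext => t; rewrite ec expR0 mul1r.
  rewrite H// => x y xP yP; apply: hol_at_comp; first exact: hol_at_cexp.
  by apply: hk; rewrite normc_cexp/= expR_le1; lra.
apply/eqP; rewrite -subr_eq0 -normr_le0; apply/ler_addgt0Pr => e e0.
rewrite add0r.
have pi1 : 0 < 2 * pi :> R by rewrite mulr_gt0// pi_gt0.
have e1 : 0 < e / (2 * pi) by rewrite divr_gt0.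
have k0 : hol_at k 0 by apply: hk; rewrite normc0 ler01.
have [d d0 dP] := hol_at_cont k0 e1.
have [n nd] : exists n : nat, expR (- n%:R) < d.
  exists (Num.truncn d^-1).+1; rewrite expRN invf_plt ?posrE ?expR_gt0//.
  by rewrite (lt_le_trans (truncnS_gt _))// (le_trans _ (expR_ge1Dx _))// lerDr.
have := @segint_dist _ 0 (2 * pi)
  (fun t => Re (k ((expR (- n%:R))%:C * cis t))) (Re (k 0)) (e / (2 * pi)) pi0.
rewrite subr0 divfK ?lt0r_neq0// -(key n); apply => x xP.
  apply: (@ccontinuous_Re _ (fun x => k ((expR (- n%:R))%:C * cis x))).
  apply: (@ccontinuous_hol _ (fun z => k ((expR (- n%:R))%:C * z))).
    exact: ccontinuous_cis.
  apply: hol_at_comp; first by apply: hol_atM; [exact: hol_at_cst|exact: hol_at_id].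
  apply: hk; rewrite normcM normc_cis mulr1 normc_real.
  by rewrite ger0_norm ?expR_ge0// expR_le1 oppr_le0.
rewrite -ReN -ReD (le_trans (normr_Re _))// -[in k (_ * _)](add0r (_ * _)).
apply/ltW/dP; rewrite normcM normc_cis mulr1 normc_real.
by rewrite ger0_norm ?expR_ge0.
Qed.
End Goursat.

(** * Periodic functions and iterated integrals *)

Section SegmentIntegrals.
Variable R : realType.
Notation mu := (@lebesgue_measure R).
Implicit Types (a b c x : R).

Lemma integral_segmentE a b (f : R -> R) : cont_on a b f ->
  (\int[mu]_(x in `[a, b]) (f x)%:E = (segint a b f)%:E)%E.
Proof.
move=> cf; rewrite /segint /Rintegral fineK//.
by apply: integrable_fin_num => //; exact: cont_on_integrable.
Qed.

Lemma segint_translate a b c (f : R -> R) : continuous f -> a <= b ->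
  segint a b (fun x => f (x + c)) = segint (a + c) (b + c) f.
Proof.
move=> cf ab; rewrite /segint /Rintegral.
have dE : derive1 (fun x : R => x + c) = cst 1.
  by apply/funext => x; rewrite derive1E deriveD// derive_id derive_cst addr0.
rewrite (@integration_by_substitution_increasing _ (fun x => x + c))//.
- by congr fine; apply: eq_integral => x _ /=; rewrite !fctE dE mulr1.
- by move=> x y _ _ xy; rewrite ltrD2r.
- by move=> x _; rewrite dE; exact: cvg_cst.
- by rewrite dE; exact: is_cvg_cst.
- by rewrite dE; exact: is_cvg_cst.
- split; first by move=> x _; exact: derivableD.
  + by apply: cvg_at_right_filter; apply: cvgD; [exact: cvg_id|exact: cvg_cst].
  + by apply: cvg_at_left_filter; apply: cvgD; [exact: cvg_id|exact: cvg_cst].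
- exact: continuous_subspaceT.
Qed.

(** Translation by c moves the interval of integration to [c, T + c]; what it
    loses at one end it regains, by periodicity, at the other. *)
Lemma segint_periodic (T : R) (f : R -> R) : 0 <= T -> continuous f ->
  (forall x, f (x + T) = f x) ->
  forall c, segint 0 T (fun x => f (x + c)) = segint 0 T f.
Proof.
move=> T0 cf pf c; rewrite segint_translate// add0r.
have cfo a b : cont_on a b f by move=> x _; exact: cf.
have shift a b : a <= b -> segint (a + T) (b + T) f = segint a b f.
  by move=> ab; rewrite -segint_translate//; congr segint; apply/funext.
have [c0|/ltW c0] := leP 0 c.
- have S1 : segint 0 (T + c) f = segint 0 c f + segint c (T + c) f.
    by apply: segint_split => //; rewrite lerDr.
  have S2 : segint 0 (T + c) f = segint 0 T f + segint T (T + c) f.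
    by apply: segint_split => //; rewrite lerDl.
  have := shift _ _ c0; rewrite add0r (addrC c T) => S3; lra.
- have S1 : segint c T f = segint c 0 f + segint 0 T f by apply: segint_split.
  have S2 : segint c T f = segint c (T + c) f + segint (T + c) T f.
    by apply: segint_split => //; rewrite ?lerDr ?gerDl.
  have := shift _ _ c0; rewrite add0r (addrC c T) => S3; lra.
Qed.

Lemma tonelli_segment a b (f : R * R -> R) : measurable_fun setT f ->
  (forall q, 0 <= f q) ->
  let F : R -> \bar R := fun s => (\int[mu]_(t in `[a, b]) (f (s, t))%:E)%E in
  measurable_fun `[a, b] F /\
  (\int[mu]_(s in `[a, b]) \int[mu]_(t in `[a, b]) (f (s, t))%:E =
   \int[mu]_(t in `[a, b]) \int[mu]_(s in `[a, b]) (f (s, t))%:E)%E.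
Proof.
move=> mf f0 F; set D := [set` `[a, b]].
have mD : measurable D by exact: measurable_itv.
pose h (q : R * R) := (f q * \1_D q.1 * \1_D q.2)%:E.
have m1 : measurable_fun setT (\1_D : R -> R) by exact: measurable_indic.
have mh : measurable_fun setT h.
  apply/measurable_EFinP; apply: measurable_funM.
    apply: measurable_funM => //.
    exact: measurableT_comp m1 measurable_fst.
  exact: measurableT_comp m1 measurable_snd.
have h0 q : (0 <= h q)%E by rewrite lee_fin !mulr_ge0// indicE.
have hs s : (\int[mu]_t h (s, t) =
    ((fun s => \int[mu]_(t in D) (f (s, t))%:E) \_ D) s)%E.
  rewrite patchE; case: ifPn => sD.
    rewrite [RHS]integral_mkcond; apply: eq_integral => t _.
    by rewrite patchE /h/= !indicE sD mulr1; case: ifPn => _; rewrite ?mulr1 ?mulr0.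
  by apply: integral0_eq => t _; rewrite /h/= !indicE (negbTE sD) mulr0 mul0r.
have ht t : (\int[mu]_s h (s, t) =
    ((fun t => \int[mu]_(s in D) (f (s, t))%:E) \_ D) t)%E.
  rewrite patchE; case: ifPn => sD.
    rewrite [RHS]integral_mkcond; apply: eq_integral => s _.
    by rewrite patchE /h/= !indicE sD mulr1; case: ifPn => _; rewrite ?mulr1 ?mulr0.
  by apply: integral0_eq => s _; rewrite /h/= !indicE (negbTE sD) mulr0.
split.
  apply/(measurable_restrictT _ _).2 => //.
  have := @measurable_fun_fubini_tonelli_F _ _ _ _ _ mu _ mh h0.
  by congr measurable_fun; apply/funext => s; exact: hs.
rewrite [LHS]integral_mkcond [RHS]integral_mkcond.
transitivity (\int[mu]_s \int[mu]_t h (s, t))%E.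
  by apply: eq_integral => s _; rewrite hs.
rewrite (@fubini_tonelli _ _ _ _ _ mu mu _ mh h0).
by apply: eq_integral => t _; rewrite ht.
Qed.

End SegmentIntegrals.

(** * Circle means increase with the radius *)

Section Subharmonic.
Variable R : realType.
Notation mu := (@lebesgue_measure R).
Implicit Types (p t s r : R) (z c : R[i]) (g k : R[i] -> R[i]).

(** The sign of u matters at the zeros of u, since powR is 1 on negative reals. *)
Lemma continuous_powR_ge0 (u : R -> R) p t : 0 < p -> (forall x, 0 <= u x) ->
  {for t, continuous u} -> {for t, continuous (fun x => u x `^ p)}.
Proof.
move=> p0 u0 cu; have [ut0|ut0] := eqVneq (u t) 0.
  apply/cvgrPdist_lt => e e0.
  have e1 : 0 < e `^ p^-1 by rewrite powR_gt0.
  have /cvgrPdist_lt/(_ _ e1) := cu; apply: filterS => x.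
  rewrite /= ut0 powR0 ?gt_eqF// !sub0r !normrN !ger0_norm ?powR_ge0// => ux.
  rewrite -[ltRHS](powRr1 (ltW e0)) -(mulVf (lt0r_neq0 p0)) powRrM.
  by rewrite gt0_ltr_powR// nnegrE ?powR_ge0.
have utp : 0 < u t by rewrite lt_def ut0 u0.
apply: (@continuous_comp _ _ _ u (fun x => x `^ p)) => //.
apply/differentiable_continuous/derivable1_diffP/derivable_powR.
by rewrite in_itv/= utp.
Qed.

(** Young's inequality, read as the supporting line of x |-> x ^ p at y. *)
Lemma powR_tangent p (x y : R) : 1 < p -> 0 <= x -> 0 <= y ->
  y `^ p + p * y `^ (p - 1) * (x - y) <= x `^ p.
Proof.
move=> p1 x0 y0; have p0 : 0 < p by lra.
pose q := p / (p - 1).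
have q0 : 0 < q by rewrite divr_gt0; lra.
have pq : p^-1 + q^-1 = 1 by rewrite /q; field; lra.
have := conjugate_powR x0 (powR_ge0 y (p - 1)) p0 q0 pq.
have -> : (y `^ (p - 1)) `^ q = y `^ p.
  by rewrite -powRrM /q mulrC divfK//; lra.
have yp : y * y `^ (p - 1) = y `^ p by rewrite mulr_powRB1.
have -> : q^-1 = 1 - p^-1 by lra.
set Y := y `^ p in yp *; set X := x `^ p; set W := y `^ (p - 1) in yp *.
rewrite -(ler_pM2l p0) mulrDr.
have -> : p * (X / p) = X by field; lra.
have -> : p * (Y * (1 - p^-1)) = p * Y - Y by field; lra.
by rewrite -yp; lra.
Qed.

(** Rotating c0 to the positive axis reduces a supporting line of |c| ^ p to the
    real case. *)
Lemma normc_powR_tangent p c0 : 1 < p -> exists lam : R[i], forall c,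
  normc c0 `^ p + Re (lam * c - lam * c0) <= normc c `^ p.
Proof.
move=> p1; have p0 : 0 < p by lra.
pose n := normc c0; pose A := p * n `^ (p - 1).
have n0 : 0 <= n by exact: normc_ge0.
have A0 : 0 <= A by rewrite mulr_ge0 ?powR_ge0// ltW.
pose u : R[i] := n%:C / c0.
exists (A%:C * u) => c.
have uc : Re (A%:C * u * c) <= A * normc c.
  rewrite (le_trans (ler_norm _))// (le_trans (normr_Re _))//.
  rewrite !normcM !normc_real normcV -/n (ger0_norm A0) (ger0_norm n0).
  rewrite -mulrA ler_wpM2l// ler_piMl ?normc_ge0//.
  by have [->|n1] := eqVneq n 0; rewrite ?mul0r// divff.
have uc0 : Re (A%:C * u * c0) = A * n.
  have [c00|c00] := eqVneq c0 0.
    by rewrite c00 mulr0/= /n c00 normc0 mulr0.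
  by rewrite -mulrA divfK// -rmorphM.
rewrite ReD ReN uc0 (le_trans _ (powR_tangent p1 (normc_ge0 c) n0))//.
rewrite lerD2l mulrBr lerD2r; exact: uc.
Qed.

Lemma sub_mean_value p k : 1 < p -> (forall z, normc z <= 1 -> hol_at k z) ->
  normc (k 0) `^ p * (2 * pi) <=
  segint 0 (2 * pi) (fun t => normc (k (cis t)) `^ p).
Proof.
move=> p1 hk; have [lam lamP] := normc_powR_tangent (k 0) p1.
have pi0 : 0 <= 2 * pi :> R by rewrite mulr_ge0// pi_ge0.
pose m z := (normc (k 0) `^ p)%:C + (lam * k z - lam * k 0).
have hm z : normc z <= 1 -> hol_at m z.
  move=> z1; apply: hol_atD; first exact: hol_at_cst.
  apply: hol_atB; last exact: hol_at_cst.
  by apply: hol_atM; [exact: hol_at_cst|exact: hk].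
have c1 t : normc (cis t : R[i]) <= 1 by rewrite normc_cis.
have -> : normc (k 0) `^ p * (2 * pi) = segint 0 (2 * pi) (fun t => Re (m (cis t))).
  by rewrite (mean_value hm) /m ReD subrr addr0.
apply: segint_le => [t _|t _|t _].
- apply: (@ccontinuous_Re _ (fun t => m (cis t))).
  by apply: ccontinuous_hol; [exact: ccontinuous_cis|exact: hm].
- apply: continuous_powR_ge0; [lra|by move=> ?; exact: normc_ge0|].
  apply: (@ccontinuous_normc _ (fun t => k (cis t))).
  by apply: ccontinuous_hol; [exact: ccontinuous_cis|exact: hk].
- by rewrite /m ReD; exact: lamP.
Qed.

(** The argument of (cis t + b) / (1 + b cis t): this number is cis t times the
    quotient of the conjugate of 1 + b cis t by 1 + b cis t, and 1 + b cis t
    has positive real part. *)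
Definition mobius_angle b t : R :=
  t - 2 * atan (b * sin t / (1 + b * cos t)).

Lemma oneDcos_gt0 b t : 0 <= b < 1 -> 0 < 1 + b * cos t.
Proof.
move=> /andP[b0 b1].
have := ler_wpM2l b0 (cos_geN1 t); lra.
Qed.

Lemma mobius_cis b t : 0 <= b < 1 ->
  (cis t + b%:C) / (1 + b%:C * cis t) = cis (mobius_angle b t).
Proof.
move=> b01; have A0 := oneDcos_gt0 t b01.
set th := atan (b * sin t / (1 + b * cos t)).
have cth : 0 < cos th by rewrite cos_gt0_pihalf// atan_gtNpi2 atan_ltpi2.
pose m := (1 + b * cos t) / cos th.
have bs : b * sin t = m * sin th.
  have : tan th = b * sin t / (1 + b * cos t) by rewrite atanK.
  rewrite /tan /m => E; rewrite mulrAC -mulrA E mulrCA divff ?mulr1//.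
  exact: lt0r_neq0.
have bc : 1 + b * cos t = m * cos th by rewrite /m divfK// lt0r_neq0.
have m0 : 0 < m by rewrite divr_gt0.
have wE : 1 + b%:C * cis t = m%:C * cis th.
  apply/eqP; rewrite eq_complex !ReD !ImD !ReM !ImM/=.
  by rewrite !mul0r !subr0 !addr0 add0r bs bc !eqxx.
have zE : cis t + b%:C = m%:C * cis (t - th).
  have -> : cis t + b%:C = cis t * (m%:C * cis (- th)).
    apply/eqP; rewrite eq_complex !ReD !ImD !ReM !ImM/=.
    rewrite cosN sinN !mul0r !subr0 !addr0 !mulrN -bs -bc.
    have := cos2Dsin2 t; set x := cos t; set y := sin t => xy.
    apply/andP; split; apply/eqP; last by ring.
    by transitivity (x + b * (x ^+ 2 + y ^+ 2)); [rewrite xy mulr1|ring].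
  by rewrite mulrCA -cisD.
have w0 : m%:C * cis th != 0.
  by rewrite -normc_gt0 normcM normc_cis mulr1 normc_real gtr0_norm.
rewrite zE wE; apply: (mulIf w0); rewrite divfK//.
rewrite mulrCA -cisD; congr (_ * cis _).
by rewrite /mobius_angle -/th; ring.
Qed.

Lemma mobius_bound b z : 0 <= b < 1 -> normc z <= 1 ->
  1 + b%:C * z != 0 /\ normc ((z + b%:C) / (1 + b%:C * z)) <= 1.
Proof.
move=> /andP[b0 b1] z1.
have w0 : 1 + b%:C * z != 0.
  apply/eqP => /eqP; rewrite addr_eq0 => /eqP/(congr1 (@normc R)).
  rewrite normc1 normc_opp normcM normc_real ger0_norm// => E.
  have : b * normc z <= b by rewrite ler_piMr.
  lra.
split=> //; rewrite normcM normcV ler_pdivrMr ?normc_gt0// mul1r.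
rewrite -(@ler_pXn2r _ 2%N) ?nnegrE ?normc_ge0// !normc_sqr.
have : normc z ^+ 2 <= 1 by rewrite expr_le1 ?normc_ge0.
rewrite normc_sqr !ReD !ImD ReM ImM/=; set x := Re z; set y := Im z.
rewrite !mul0r !subr0 !addr0 add0r => xy; rewrite -subr_ge0.
have -> : (1 + b * x) ^+ 2 + (b * y) ^+ 2 - ((x + b) ^+ 2 + y ^+ 2) =
  (1 - b ^+ 2) * (1 - (x ^+ 2 + y ^+ 2)) by ring.
by rewrite mulr_ge0 ?subr_ge0// expr_le1// ltW.
Qed.

Definition cmean p g r : R :=
  (2 * pi)^-1 * segint 0 (2 * pi) (fun t => normc (g (r%:C * cis t)) `^ p).

Lemma normc_circle r t : 0 <= r -> normc (r%:C * cis t) = r.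
Proof. by move=> r0; rewrite normcM normc_cis mulr1 normc_real ger0_norm. Qed.

Lemma circle_continuous p g r : 0 < p -> holomorphic_disk g -> 0 <= r < 1 ->
  continuous (fun t => normc (g (r%:C * cis t)) `^ p).
Proof.
move=> p0 hg /andP[r0 r1] t; apply: continuous_powR_ge0 => // [x|].
  exact: normc_ge0.
apply: (@ccontinuous_normc _ (fun t => g (r%:C * cis t))).
apply: (@ccontinuous_hol _ (fun z => g (r%:C * z))); first exact: ccontinuous_cis.
apply: hol_at_comp; first by apply: hol_atM; [exact: hol_at_cst|exact: hol_at_id].
by apply: hg; rewrite normc_circle.
Qed.

Lemma circle_meanE p g r : 0 < p -> holomorphic_disk g -> 0 <= r < 1 ->
  circle_mean p g r = (cmean p g r)%:E.
Proof.
move=> p0 hg r01; rewrite /circle_mean /cmean EFinM; congr (_ * _)%E.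
by apply: integral_segmentE => t _; exact: circle_continuous.
Qed.

Lemma continuous_mobius_angle b : 0 <= b < 1 -> continuous (mobius_angle b).
Proof.
move=> b01 t; apply: cvgB; first exact: cvg_id.
apply: cvgM; first exact: cvg_cst.
apply: (@continuous_comp _ _ _ (fun t => b * sin t / (1 + b * cos t)) atan).
  apply: cvgM.
    by apply: cvgM; [exact: cvg_cst|exact: continuous_sin].
  apply: cvgV; first by rewrite lt0r_neq0// oneDcos_gt0.
  apply: cvgD; first exact: cvg_cst.
  by apply: cvgM; [exact: cvg_cst|exact: continuous_cos].
exact: continuous_atan.
Qed.

(** The sub-mean value inequality at a point of modulus r b, through the
    automorphism of the disk of radius r that maps 0 to this point. *)
Lemma circle_sub_mean p g r b s : 1 < p -> holomorphic_disk g -> 0 <= r < 1 ->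
  0 <= b < 1 ->
  normc (g ((r * b)%:C * cis s)) `^ p * (2 * pi) <=
  segint 0 (2 * pi) (fun t => normc (g (r%:C * cis (s + mobius_angle b t))) `^ p).
Proof.
move=> p1 hg /andP[r0 r1] b01.
pose k z := g (r%:C * cis s * ((z + b%:C) / (1 + b%:C * z))).
have E : (fun t => normc (k (cis t)) `^ p) =
    (fun t => normc (g (r%:C * cis (s + mobius_angle b t))) `^ p).
  by apply/funext => t; rewrite /k mobius_cis// -mulrA -cisD.
have k0 : k 0 = g ((r * b)%:C * cis s).
  by rewrite /k add0r mulr0 addr0 divr1 mulrAC -rmorphM.
rewrite -k0 -E; apply: sub_mean_value => // z z1.
rewrite /k; have [w0 wle] := mobius_bound b01 z1.
apply: (@hol_at_comp _ (fun z => r%:C * cis s * ((z + b%:C) / (1 + b%:C * z)))).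
  apply: hol_atM; first exact: hol_at_cst.
  apply: hol_atM.
    by apply: hol_atD; [exact: hol_at_id|exact: hol_at_cst].
  apply: hol_atV => //; apply: hol_atD; first exact: hol_at_cst.
  by apply: hol_atM; [exact: hol_at_cst|exact: hol_at_id].
apply: hg; rewrite normcM normc_circle// (le_lt_trans _ r1)//.
by rewrite ler_piMr.
Qed.

(** When u is integrated, the order of integration on the right can be
    exchanged, and every rotate of G has the same integral over a period. *)
Lemma segint_le_rotation_average (T : R) (G a u : R -> R) : 0 < T ->
  continuous G -> (forall x, G (x + T) = G x) -> (forall x, 0 <= G x) ->
  continuous a -> continuous u -> (forall x, 0 <= u x) ->
  (forall s, u s * T <= segint 0 T (fun t => G (s + a t))) ->
  segint 0 T u <= segint 0 T G.
Proof.
move=> T0 cG perG G0 ca cu u0 uG.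
pose f (q : R * R) := G (q.1 + a q.2).
have mf : measurable_fun setT f.
  apply: (measurableT_comp (f := G)); first exact: continuous_measurable_fun.
  apply: measurable_funD; first exact: measurable_fst.
  apply: (measurableT_comp (f := a)); last exact: measurable_snd.
  exact: continuous_measurable_fun.
have f0 q : 0 <= f q by exact: G0.
have [mF swap] := tonelli_segment 0 T mf f0.
have cGa s : cont_on 0 T (fun t => G (s + a t)).
  move=> t _; apply: (@continuous_comp _ _ _ (fun t => s + a t) G); last exact: cG.
  by apply: cvgD; [exact: cvg_cst|exact: ca].
have cGs t : cont_on 0 T (fun s => G (s + a t)).
  move=> s _; apply: (@continuous_comp _ _ _ (fun s => s + a t) G); last exact: cG.
  by apply: cvgD; [exact: cvg_id|exact: cvg_cst].
have inner t : (\int[mu]_(s in `[0%R, T]) (f (s, t))%:E = (segint 0 T G)%:E)%E.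
  transitivity (segint 0 T (fun s => G (s + a t)))%:E.
    exact: (integral_segmentE (@cGs t)).
  by rewrite (segint_periodic (ltW T0) cG perG).
have le12 : (\int[mu]_(s in `[0%R, T]) (u s * T)%:E <=
     \int[mu]_(s in `[0%R, T]) \int[mu]_(t in `[0%R, T]) (f (s, t))%:E)%E.
  apply: ge0_le_integral => //.
  - by move=> s _; rewrite lee_fin mulr_ge0// ltW.
  - apply/measurable_EFinP/measurable_funTS/measurable_funM => //.
    exact: continuous_measurable_fun.
  - by move=> s _; rewrite (integral_segmentE (@cGa s)) lee_fin.
move: le12; rewrite swap; under [X in (_ <= X)%E -> _]eq_integral do rewrite inner.
rewrite integral_cst//= lebesgue_measure_itv/= lte_fin T0 sube0 -EFinM.
rewrite integral_segmentE; last first.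
  by move=> s _; apply: cvgM; [exact: cu|exact: cvg_cst].
rewrite lee_fin {1}/segint RintegralZr//; last first.
  by apply: cont_on_integrable => s _; exact: cu.
by rewrite ler_pM2r.
Qed.

(** The value of |g| ^ p at a point of the inner circle is at most a weighted
    mean of its values on the outer one, and the weights only depend on the
    difference of the arguments. *)
Lemma cmean_le p g rho r : 1 < p -> holomorphic_disk g -> 0 <= rho -> rho < r ->
  r < 1 -> cmean p g rho <= cmean p g r.
Proof.
move=> p1 hg rho0 rr r1; have p0 : 0 < p by lra.
have r0 : 0 < r by lra.
have r01 : 0 <= r < 1 by lra.
have rho01 : 0 <= rho < 1 by lra.
have b01 : 0 <= rho / r < 1 by rewrite ltr_pdivrMr// mul1r rr andbT divr_ge0// ltW.
have pi0 : 0 < 2 * pi :> R by rewrite mulr_gt0// pi_gt0.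
apply: ler_wpM2l; first by rewrite invr_ge0 ltW.
apply: (@segint_le_rotation_average _ _ (mobius_angle (rho / r))) => //.
- exact: circle_continuous.
- by move=> x; rewrite cisD cis2pi mulr1.
- by move=> x; exact: powR_ge0.
- exact: continuous_mobius_angle.
- exact: circle_continuous.
- by move=> x; exact: powR_ge0.
move=> s; have := @circle_sub_mean p g r (rho / r) s p1 hg r01 b01.
by rewrite (mulrC r) divfK ?lt0r_neq0.
Qed.

End Subharmonic.

(** * The Hardy norm as a limit of circle means *)

Section HardyNorm.
Variable R : realType.
Variable p : R.
Hypothesis p1 : 1 < p.
Implicit Types (r e B : R) (c : R[i]) (f g u v : R[i] -> R[i]).

Let p0 : 0 < p. Proof. exact: lt_trans ltr01 p1. Qed.

Notation N g := (hardy_norm p g).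

Lemma ler_powR_base (x y : R) : 0 <= x -> x <= y -> x `^ p <= y `^ p.
Proof.
move=> x0 xy; apply: ge0_ler_powR => //; first exact: ltW.
by rewrite nnegrE (le_trans x0).
Qed.

Lemma powR_ler_cancel (x y : R) : 0 <= x -> 0 <= y -> x `^ p <= y `^ p -> x <= y.
Proof.
move=> x0 y0; apply: contraTT; rewrite -!ltNge => yx.
by apply: gt0_ltr_powR.
Qed.

Lemma hardy_norm_ge0 g : 0 <= N g.
Proof. by rewrite /hardy_norm /hardy_enorm fine_poweR powR_ge0. Qed.

Lemma hardy_supE g : Hardy p g ->
  ereal_sup [set circle_mean p g r | r in `[0%R, 1%R[] = (N g `^ p)%:E.
Proof.
rewrite /hardy_norm /hardy_enorm => -[hg]; set S := ereal_sup _ => Sfin.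
have S0 : (0 <= S)%E.
  apply: (@le_trans _ _ (circle_mean p g 0)).
    rewrite mule_ge0//; first by rewrite lee_fin invr_ge0 mulr_ge0// pi_ge0.
    by apply: integral_ge0 => x _; rewrite lee_fin powR_ge0.
  by apply: ereal_sup_ubound; exists 0 => //=; rewrite in_itv/= lexx ltr01.
have /lty_poweRy : (poweR S p^-1 < +oo)%E by [].
rewrite invr_neq0 ?lt0r_neq0// => /(_ isT) Sy.
have Sf : S \is a fin_num by rewrite ge0_fin_numE.
rewrite fine_poweR -powRrM mulVf ?lt0r_neq0// powRr1 ?fine_ge0//.
by rewrite fineK.
Qed.

Lemma hardy_enormE g : Hardy p g -> hardy_enorm p g = (N g)%:E.
Proof.
move=> [_ fin]; rewrite /hardy_norm fineK// ge0_fin_numE//.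
exact: poweR_ge0.
Qed.

Lemma cmean_le_norm g r : Hardy p g -> 0 <= r < 1 -> cmean p g r <= N g `^ p.
Proof.
move=> hg r01; rewrite -lee_fin -hardy_supE// -circle_meanE//; last exact: hg.1.
by apply: ereal_sup_ubound; exists r.
Qed.

Lemma hardy_norm_le g B : Hardy p g ->
  (forall r, 0 <= r < 1 -> cmean p g r <= B) -> N g `^ p <= B.
Proof.
move=> hg H; rewrite -lee_fin -hardy_supE//.
apply: ge_ereal_sup => x [r /=]; rewrite in_itv/= => r01 <-.
by rewrite circle_meanE ?lee_fin ?H//; exact: hg.1.
Qed.

Lemma hardy_bounded g B : holomorphic_disk g ->
  (forall r, 0 <= r < 1 -> cmean p g r <= B) -> Hardy p g.
Proof.
move=> hg H; split; first exact: hg.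
rewrite /hardy_enorm poweR_lty//.
apply: (@le_lt_trans _ _ B%:E); last exact: ltry.
apply: ge_ereal_sup => x [r /=]; rewrite in_itv/= => r01 <-.
by rewrite circle_meanE ?lee_fin ?H.
Qed.

(** Monotonicity turns the supremum into a limit. *)
Lemma cmean_cvg_norm g e : Hardy p g -> 0 < e -> exists2 r0, 0 <= r0 < 1 &
  forall r, r0 < r < 1 -> N g `^ p - e < cmean p g r.
Proof.
move=> hg e0.
have : ((N g `^ p - e)%:E < (N g `^ p)%:E)%E by rewrite lte_fin; lra.
rewrite -(hardy_supE hg) => /ereal_sup_gt[x [r0 /=]].
rewrite in_itv/= => r01 <-; rewrite circle_meanE//; last exact: hg.1.
rewrite lte_fin => lt0; exists r0; first exact: r01.
move=> r /andP[r0r r1]; apply: lt_le_trans lt0 _.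
by case/andP: r01 => r00 _; exact: cmean_le p1 hg.1 r00 r0r r1.
Qed.

Lemma cmean0 g : cmean p g 0 = normc (g 0) `^ p.
Proof.
rewrite /cmean; under [X in segint _ _ X]funext do rewrite mul0r.
rewrite segint_cst ?subr0 ?mulr_ge0 ?pi_ge0// mulrCA mulVf ?mulr1//.
by rewrite mulf_neq0// lt0r_neq0// pi_gt0.
Qed.

(** The circle of radius 0 is one of those over which the supremum is taken. *)
Lemma norm0_le_hardy g : Hardy p g -> normc (g 0) <= N g.
Proof.
move=> hg; have := cmean_le_norm hg; move=> /(_ 0); rewrite lexx ltr01 => /(_ isT).
rewrite cmean0; apply: powR_ler_cancel; first exact: normc_ge0.
exact: hardy_norm_ge0.
Qed.

Lemma circle_cont_on g r a b : holomorphic_disk g -> 0 <= r < 1 ->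
  cont_on a b (fun t => normc (g (r%:C * cis t)) `^ p).
Proof. by move=> hg r01 t _; exact: circle_continuous. Qed.

Lemma cmean_lin u1 u2 v1 v2 (a1 a2 b1 b2 : R) r :
  holomorphic_disk u1 -> holomorphic_disk u2 ->
  holomorphic_disk v1 -> holomorphic_disk v2 -> 0 <= r < 1 ->
  (forall z, normc z < 1 ->
    a1 * normc (u1 z) `^ p + a2 * normc (u2 z) `^ p <=
    b1 * normc (v1 z) `^ p + b2 * normc (v2 z) `^ p) ->
  a1 * cmean p u1 r + a2 * cmean p u2 r <= b1 * cmean p v1 r + b2 * cmean p v2 r.
Proof.
move=> hu1 hu2 hv1 hv2 r01 H.
have cZ g a : holomorphic_disk g ->
    cont_on 0 (2 * pi) (fun t => a * normc (g (r%:C * cis t)) `^ p).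
  by move=> hg t tP; apply: cvgM; [exact: cvg_cst|exact: circle_cont_on tP].
have lin g h a b : holomorphic_disk g -> holomorphic_disk h ->
    a * cmean p g r + b * cmean p h r = (2 * pi)^-1 * segint 0 (2 * pi)
    (fun t => a * normc (g (r%:C * cis t)) `^ p
            + b * normc (h (r%:C * cis t)) `^ p).
  move=> hg hh; rewrite /cmean mulrCA (mulrCA b) -mulrDr; congr (_ * _).
  rewrite /segint RintegralD//; last 2 first.
  - by apply: cont_on_integrable; exact: cZ.
  - by apply: cont_on_integrable; exact: cZ.
  by congr (_ + _); rewrite RintegralZl//; apply: cont_on_integrable;
    exact: circle_cont_on.
rewrite (lin u1 u2 a1 a2 hu1 hu2) (lin v1 v2 b1 b2 hv1 hv2).
apply: ler_wpM2l; first by rewrite invr_ge0 mulr_ge0 ?pi_ge0.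
apply: segint_le => [t tP|t tP|t _].
- by apply: cvgD; exact: cZ tP.
- by apply: cvgD; exact: cZ tP.
- by apply: H; rewrite normc_circle; lra.
Qed.

Lemma le_lin_approx (a1 a2 b1 b2 e d U1 U2 V1 V2 u1 u2 v1 v2 : R) :
  0 <= a1 -> 0 <= a2 -> 0 <= b1 -> 0 <= b2 -> (a1 + a2) * d <= e ->
  U1 - d < u1 -> U2 - d < u2 -> v1 <= V1 -> v2 <= V2 ->
  a1 * u1 + a2 * u2 <= b1 * v1 + b2 * v2 ->
  a1 * U1 + a2 * U2 <= b1 * V1 + b2 * V2 + e.
Proof.
move=> a10 a20 b10 b20 de /ltW/(ler_wpM2l a10) H1 /ltW/(ler_wpM2l a20) H2.
by move=> /(ler_wpM2l b10) H3 /(ler_wpM2l b20) H4; lra.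
Qed.

(** All four circle means are close to their suprema on one and the same circle,
    so a linear inequality between p-th powers passes to the norms. *)
Lemma hardy_lin u1 u2 v1 v2 (a1 a2 b1 b2 : R) :
  Hardy p u1 -> Hardy p u2 -> Hardy p v1 -> Hardy p v2 ->
  0 <= a1 -> 0 <= a2 -> 0 <= b1 -> 0 <= b2 ->
  (forall z, normc z < 1 ->
    a1 * normc (u1 z) `^ p + a2 * normc (u2 z) `^ p <=
    b1 * normc (v1 z) `^ p + b2 * normc (v2 z) `^ p) ->
  a1 * N u1 `^ p + a2 * N u2 `^ p <= b1 * N v1 `^ p + b2 * N v2 `^ p.
Proof.
move=> hu1 hu2 hv1 hv2 a10 a20 b10 b20 H.
apply/ler_addgt0Pr => e e0.
have [d d0 de] : exists2 d, 0 < d & (a1 + a2) * d <= e.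
  exists (e / (a1 + a2 + 1)); first by rewrite divr_gt0// ltr_wpDl ?addr_ge0.
  by rewrite mulrCA ler_piMr ?(ltW e0)// ler_pdivrMr; lra.
have [r1 r11 H1] := cmean_cvg_norm hu1 d0.
have [r2 r21 H2] := cmean_cvg_norm hu2 d0.
have [r r01 [rr1 rr2]] : exists2 r, 0 <= r < 1 & r1 < r < 1 /\ r2 < r < 1.
  clear H1 H2; exists ((Num.max r1 r2 + 1) / 2);
    by have [m|m] := leP r1 r2; lra.
apply: (le_lin_approx a10 a20 b10 b20 de (H1 _ rr1) (H2 _ rr2)
  (cmean_le_norm hv1 r01) (cmean_le_norm hv2 r01)).
exact: cmean_lin hu1.1 hu2.1 hv1.1 hv2.1 r01 H.
Qed.

Lemma hardy_normZ g c : Hardy p g -> Hardy p (fun z => c * g z) ->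
  N (fun z => c * g z) `^ p = normc c `^ p * N g `^ p.
Proof.
move=> hg hcg; have cE z : normc (c * g z) `^ p = normc c `^ p * normc (g z) `^ p.
  by rewrite normcM powRM ?normc_ge0.
apply/eqP; rewrite eq_le; apply/andP; split.
- have := @hardy_lin _ g g g 1 0 (normc c `^ p) 0 hcg hg hg hg.
  rewrite !mul1r !mul0r !addr0; apply; rewrite ?ler01 ?powR_ge0// => z _.
  by rewrite !mul1r !mul0r !addr0 cE.
- have := @hardy_lin g g _ g (normc c `^ p) 0 1 0 hg hg hcg hg.
  rewrite !mul1r !mul0r !addr0; apply; rewrite ?ler01 ?powR_ge0// => z _.
  by rewrite !mul1r !mul0r !addr0 cE.
Qed.

Lemma hol_disk_cst c : @holomorphic_disk R (fun=> c).
Proof. by move=> z _; exact: hol_at_cst. Qed.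

Lemma hardy_affine f (P : R[i] -> R[i]) A c : Hardy p f ->
  (forall z, normc z < 1 -> hol_at P z) ->
  (forall z, normc z < 1 -> normc (P z) <= A) ->
  Hardy p (fun z => P z * f z + c).
Proof.
move=> hf hP PA.
have A0 : 0 <= A by rewrite (le_trans _ (PA 0 _)) ?normc_ge0// normc0 ltr01.
have hol : holomorphic_disk (fun z => P z * f z + c).
  move=> z z1; apply: hol_atD; last exact: hol_at_cst.
  by apply: hol_atM; [exact: hP|exact: hf.1].
(* (x + y) ^ p <= (2 max (x, y)) ^ p <= (2 x) ^ p + (2 y) ^ p. *)
apply: (@hardy_bounded _ ((2 * A) `^ p * N f `^ p + (2 * normc c) `^ p)) => //.
move=> r r01.
have : 1 * cmean p (fun z => P z * f z + c) r + 0 * cmean p (fun=> 0) r <=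
    (2 * A) `^ p * cmean p f r + (2 * normc c) `^ p * cmean p (fun=> 1) r.
  apply: (cmean_lin hol (@hol_disk_cst 0) hf.1 (@hol_disk_cst 1) r01) => z z1.
  rewrite mul1r mul0r addr0 normc1 powR1 mulr1.
  have fz : 0 <= normc (f z) by exact: normc_ge0.
  have cz : 0 <= normc c by exact: normc_ge0.
  rewrite -powRM//; last by rewrite mulr_ge0.
  have le1 : normc (P z * f z + c) <= A * normc (f z) + normc c.
    rewrite (le_trans (ler_normcD _ _))// lerD2r normcM ler_wpM2r// PA//.
  have [le|/ltW le] := leP (A * normc (f z)) (normc c).
  - rewrite ler_wpDl ?powR_ge0//; apply: ler_powR_base; rewrite ?normc_ge0//.
    by rewrite (le_trans le1)//; lra.
  - rewrite ler_wpDr ?powR_ge0//; apply: ler_powR_base; rewrite ?normc_ge0//.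
    by rewrite (le_trans le1)//; lra.
rewrite mul1r mul0r addr0 => /le_trans; apply.
rewrite lerD//; first by rewrite ler_wpM2l ?powR_ge0// cmean_le_norm.
have pi0 : 0 < 2 * pi :> R by rewrite mulr_gt0// pi_gt0.
rewrite ler_piMr ?powR_ge0// /cmean normc1 powR1 segint_cst ?(ltW pi0)//.
by rewrite mul1r subr0 mulVf// lt0r_neq0.
Qed.

Lemma hardy_norm_cst c : Hardy p (fun=> c) -> N (fun=> c) <= normc c.
Proof.
move=> hc; apply: powR_ler_cancel; [exact: hardy_norm_ge0|exact: normc_ge0|].
apply: hardy_norm_le => // r _.
have pi0 : 0 < 2 * pi :> R by rewrite mulr_gt0// pi_gt0.
rewrite /cmean segint_cst ?(ltW pi0)// subr0 mulrCA mulVf ?mulr1//.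
exact: lt0r_neq0.
Qed.

End HardyNorm.

(** * Convexity of powers *)

Section ConvexPowers.
Variable R : realType.
Implicit Types (h : R -> R) (x y l A B C theta e : R).

Definition convex_ge0 h := forall l x y, 0 <= l <= 1 -> 0 <= x -> 0 <= y ->
  h (l * x + (1 - l) * y) <= l * h x + (1 - l) * h y.

Lemma convex_superadd h x y : convex_ge0 h -> h 0 = 0 -> 0 <= x -> 0 <= y ->
  h x + h y <= h (x + y).
Proof.
move=> ch h0 x0 y0; have [s0|s0] := eqVneq (x + y) 0.
  have [-> ->] : x = 0 /\ y = 0 by lra.
  by rewrite addr0 h0 addr0.
have sp : 0 < x + y by rewrite lt_def s0 addr_ge0.
have S z : 0 <= z <= x + y -> h z <= z / (x + y) * h (x + y).
  move=> /andP[z0 zs]; have := ch (z / (x + y)) (x + y) 0.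
  rewrite divr_ge0 ?(ltW sp)// ler_pdivrMr// mul1r zs => /(_ isT isT (lexx _)).
  by rewrite mulr0 addr0 h0 mulr0 addr0 divfK.
have := S x; have := S y; rewrite x0 y0 lerDl lerDr x0 y0.
move=> /(_ isT) H1 /(_ isT) H2; rewrite (le_trans (lerD H2 H1))//.
by rewrite -mulrDl -mulrDl divff// mul1r.
Qed.

Lemma convex_midpoint h x y : convex_ge0 h -> 0 <= x -> 0 <= y ->
  2 * h ((x + y) / 2) <= h x + h y.
Proof.
move=> ch x0 y0; have l01 : 0 <= (2^-1 : R) <= 1 by lra.
have := ch _ _ _ l01 x0 y0.
have -> : 2^-1 * x + (1 - 2^-1) * y = (x + y) / 2 by lra.
lra.
Qed.

(** A + B and A - B are opposite convex combinations of A + C and A - C. *)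
Lemma convex_spread h A B C : convex_ge0 h -> `|B| <= C -> C <= A ->
  h (A + B) + h (A - B) <= h (A + C) + h (A - C).
Proof.
move=> ch BC CA; have C0 : 0 <= C by rewrite (le_trans (normr_ge0 B)).
move: BC; rewrite ler_norml => /andP[B1 B2].
have [c0|cn0] := eqVneq C 0.
  by have -> : B = C by lra.
have Cp : 0 < C by rewrite lt_def cn0 C0.
pose l := (C + B) / (2 * C).
have l01 : 0 <= l <= 1.
  by rewrite divr_ge0 ?ler_pdivrMr; lra.
have P0 : 0 <= A + C by lra.
have M0 : 0 <= A - C by lra.
have := ch l _ _ l01 P0 M0; have := ch l _ _ l01 M0 P0.
have -> : l * (A + C) + (1 - l) * (A - C) = A + B by rewrite /l; field.
have -> : l * (A - C) + (1 - l) * (A + C) = A - B by rewrite /l; field.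
lra.
Qed.

(** The weighted arithmetic-geometric mean inequality, read as a supporting
    line. *)
Lemma powR_tangent_concave theta x y : 0 < theta < 1 -> 0 <= x -> 0 < y ->
  x `^ theta <= y `^ theta + theta * y `^ (theta - 1) * (x - y).
Proof.
move=> /andP[t0 t1] x0 y0.
have p0 : 0 < theta^-1 by rewrite invr_gt0.
have q0 : 0 < (1 - theta)^-1 by rewrite invr_gt0 subr_gt0.
have pq : theta^-1^-1 + (1 - theta)^-1^-1 = 1 by rewrite !invrK; ring.
have := conjugate_powR (powR_ge0 x theta) (powR_ge0 y (1 - theta)) p0 q0 pq.
rewrite -!powRrM !divff ?lt0r_neq0 ?subr_gt0// !powRr1 ?(ltW y0)// !invrK => H.
have Y : y `^ (1 - theta) * y `^ (theta - 1) = 1.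
  rewrite -powRD ?lt0r_neq0 ?implybT//.
  by rewrite (_ : 1 - theta + (theta - 1) = 0) ?powRr0//; ring.
have yt : y * y `^ (theta - 1) = y `^ theta by rewrite mulr_powRB1 ?ltW.
have := ler_wpM2r (powR_ge0 y (theta - 1)) H.
rewrite -(mulrA (x `^ theta)) Y mulr1 mulrDl -[y * _ * _]mulrAC yt.
by move/le_trans; apply; rewrite -yt; lra.
Qed.

(** The sign e for which e x ^ theta is convex in x >= 0.  With theta = p / 2
    it allows the cases p > 2 and p < 2, where all inequalities are reversed,
    to be treated at once. *)
Definition cvx_sign e theta := (e = 1 /\ 1 < theta) \/ (e = -1 /\ 0 < theta < 1).

Lemma cvx_sign_gt0 e theta : cvx_sign e theta -> 0 < theta.
Proof. by case=> -[_]; lra. Qed.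

Lemma cvx_sign_convex e theta : cvx_sign e theta ->
  convex_ge0 (fun x => e * x `^ theta).
Proof.
move=> se l x y /andP[l0 l1] x0 y0.
have t0 := cvx_sign_gt0 se.
have lx : 0 <= l * x by rewrite mulr_ge0.
have ly : 0 <= (1 - l) * y by rewrite mulr_ge0// subr_ge0.
set z := l * x + (1 - l) * y.
have zP : 0 <= z by rewrite addr_ge0.
have K a b : l * (a * (x - z)) + (1 - l) * (a * (y - z)) + b = b.
  by rewrite /z; ring.
case: se => -[-> th].
- have := ler_wpM2l l0 (powR_tangent th x0 zP).
  have := @ler_wpM2l _ (1 - l) _ _ _ (powR_tangent th y0 zP).
  rewrite subr_ge0 => /(_ l1).
  have := K (theta * z `^ (theta - 1)) (z `^ theta); lra.
- have [z0|z0] := eqVneq z 0.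
    rewrite z0 powR0 ?lt0r_neq0// mulr0.
    have Z a b : a * b = 0 -> a * b `^ theta = 0.
      move/eqP; rewrite mulf_eq0 => /orP[|] /eqP->; first by rewrite mul0r.
      by rewrite powR0 ?mulr0// lt0r_neq0.
    have -> : l * (-1 * x `^ theta) + (1 - l) * (-1 * y `^ theta) =
       - (l * x `^ theta) - (1 - l) * y `^ theta by ring.
    by rewrite !Z ?oppr0 ?addr0//; rewrite /z in z0; lra.
  have zp : 0 < z by rewrite lt_def z0.
  have := ler_wpM2l l0 (powR_tangent_concave th x0 zp).
  have := @ler_wpM2l _ (1 - l) _ _ _ (powR_tangent_concave th y0 zp).
  rewrite subr_ge0 => /(_ l1).
  have := K (theta * z `^ (theta - 1)) (z `^ theta); lra.
Qed.

(** Hoelder's inequality for two terms with a fixed weight, which makes it linear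
    in the powers: it is convexity at the points x / l and y / (1 - l). *)
Lemma cvx_sign_hoelder e theta l x y : cvx_sign e theta -> 0 < l < 1 -> 0 <= x -> 0 <= y ->
  e * (x + y) `^ theta <=
  l `^ (1 - theta) * (e * x `^ theta) + (1 - l) `^ (1 - theta) * (e * y `^ theta).
Proof.
move=> se /andP[l0 l1] x0 y0; have l10 : 0 < 1 - l by rewrite subr_gt0.
have := @cvx_sign_convex _ _ se l (x / l) (y / (1 - l)).
have -> : l * (x / l) + (1 - l) * (y / (1 - l)) = x + y.
  by field; rewrite !lt0r_neq0.
rewrite (ltW l0) (ltW l1) !divr_ge0 ?(ltW l0) ?(ltW l10)//= => /(_ isT isT isT).
have D a b : 0 < a -> 0 <= b ->
    a * (e * (b / a) `^ theta) = a `^ (1 - theta) * (e * b `^ theta).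
  move=> a0 b0; have a0' := ltW a0; rewrite powRM ?invr_ge0//.
  rewrite powRB ?lt0r_neq0 ?implybT// powRr1//.
  rewrite -(powR_inv1 a0') -powRrM mulN1r powRN; ring.
by rewrite !D.
Qed.

Lemma ler_cvx_sign e theta r x y : cvx_sign e theta -> 0 <= r -> 0 <= x -> 0 <= y ->
  e * x <= e * y -> e * x `^ r <= e * y `^ r.
Proof.
move=> se r0 x0 y0; case: se => -[-> _]; rewrite ?mul1r ?mulN1r ?lerN2 => xy;
  by apply: ge0_ler_powR; rewrite ?nnegrE.
Qed.

Lemma cvx_signV e theta : cvx_sign e theta -> cvx_sign (- e) theta^-1.
Proof.
case=> -[-> th]; [right|left]; split; rewrite ?opprK//.
- by rewrite invr_gt0 invf_lt1 ?th ?andbT//; lra.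
- by rewrite invf_gt1; lra.
Qed.

Lemma le_powR_limit1 c e X : (forall l, 0 < l < 1 -> X <= l `^ e * c) -> X <= c.
Proof.
move=> H; rewrite leNgt; apply/negP => cX.
have cont1 : {for 1, continuous (fun l : R => l `^ e)}.
  apply/differentiable_continuous/derivable1_diffP/derivable_powR.
  by rewrite in_itv/= ltr01.
have cont : {for 1, continuous (fun l : R => l `^ e * c)}.
  by apply: cvgM; [exact: cont1|exact: cvg_cst].
have cX0 : 0 < X - c by rewrite subr_gt0.
have /cvgrPdist_lt/(_ _ cX0)/nbhs_ballP[d /= d0 dP] := cont.
pose l := 1 - Num.min (d / 2) (2^-1).
have m0 : 0 < Num.min (d / 2) (2^-1) by rewrite lt_min invr_gt0 ltr0n divr_gt0.
have m1 : Num.min (d / 2) (2^-1) <= 2^-1 by rewrite ge_min lexx orbT.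
have m2 : Num.min (d / 2) (2^-1) <= d / 2 by rewrite ge_min lexx.
have := H l; have := dP l.
rewrite /ball/= /l opprB addrC subrK gtr0_norm// powR1 mul1r.
have -> : Num.min (d / 2) 2^-1 < d by lra.
move=> /(_ isT); rewrite ltr_norml => /andP[H1 _].
have -> : 0 < 1 - Num.min (d / 2) 2^-1 < 1 by lra.
move=> /(_ isT); lra.
Qed.

(** The best weight is s / (s + t).  If s or t is zero it is 0 or 1, where the
    weighted bound is only available as a limit. *)
Lemma cvx_sign_le_sum_powR e theta s t X : cvx_sign e theta -> 0 <= s -> 0 <= t ->
  (forall l, 0 < l < 1 -> X <= l `^ (1 - theta) * (e * s `^ theta) +
    (1 - l) `^ (1 - theta) * (e * t `^ theta)) ->
  X <= e * (s + t) `^ theta.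
Proof.
move=> se s0 t0 H; have th0 := cvx_sign_gt0 se.
have z0 : 0 `^ theta = 0 :> R by rewrite powR0 ?lt0r_neq0.
have [s00|sn0] := eqVneq s 0.
  rewrite s00 add0r; apply: (@le_powR_limit1 _ (1 - theta)) => l l01.
  have l01' : 0 < 1 - l < 1 by lra.
  by have := H _ l01'; rewrite subKr s00 z0 !mulr0 add0r.
have [t00|tn0] := eqVneq t 0.
  rewrite t00 addr0; apply: (@le_powR_limit1 _ (1 - theta)) => l l01.
  by have := H _ l01; rewrite t00 z0 !mulr0 addr0.
have sp : 0 < s by rewrite lt_def sn0.
have tp : 0 < t by rewrite lt_def tn0.
have stp : 0 < s + t by rewrite addr_gt0.
have l01 : 0 < s / (s + t) < 1 by rewrite divr_gt0//= ltr_pdivrMr//; lra.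
have E a : 0 < a ->
    (a / (s + t)) `^ (1 - theta) * (e * a `^ theta) =
    e * (a * (s + t) `^ (theta - 1)).
  move=> a0; rewrite powRM ?invr_ge0 ?(ltW a0) ?(ltW stp)//.
  rewrite -(powR_inv1 (ltW stp)) -powRrM mulN1r opprB.
  have {3}-> : a = a `^ (1 - theta) * a `^ theta.
    by rewrite -powRD ?subrK ?powRr1 ?(ltW a0)// lt0r_neq0 ?implybT.
  by ring.
have := H _ l01; have -> : 1 - s / (s + t) = t / (s + t) by field; rewrite lt0r_neq0.
by rewrite !E// -mulrDr -mulrDl mulr_powRB1// ltW.
Qed.

End ConvexPowers.

(** * Parallelogram inequalities for complex numbers *)

Section TwoPoint.
Variable R : realType.
Implicit Types (x y a e p q : R).

Lemma derive_nonpos_le (f df : R -> R) (b : R) : 0 <= b ->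
  (forall x, 0 <= x <= b -> is_derive x 1 f (df x)) ->
  (forall x, 0 <= x <= b -> df x <= 0) -> f b <= f 0.
Proof.
move=> b0 fd d0.
have [x||c cb E] := @MVT_segment R f df 0 b b0.
- by rewrite in_itv/= => /andP[x0 xb]; apply: fd; rewrite !ltW.
- apply: continuous_in_subspaceT => x /[!inE]/=; rewrite in_itv/= => xb.
  by have [fx _] := fd x xb; exact/differentiable_continuous/derivable1_diffP.
rewrite -subr_le0 E subr0 mulr_le0_ge0// d0//.
Qed.

Lemma is_derive_powR_shift x a (s : R) : 0 < 1 + s * x ->
  is_derive x 1 (fun y => (1 + s * y) `^ a) (s * (a * (1 + s * x) `^ (a - 1))).
Proof.
move=> x0.
have d1 : is_derive x 1 (fun y => 1 + s * y) s.
  have H : is_derive x 1 (cst 1 + s *: id) (0 + s *: 1) by exact: is_deriveD.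
  by apply: is_derive_eq; rewrite add0r [_ *: _]mulr1.
have := is_derive1_comp (g := fun y => 1 + s * y) (f := fun z => z `^ a)
  (is_derive1_powR a x0) d1.
by rewrite mulrC.
Qed.

Lemma cvx_sign_powR_mono e p (a b : R) : cvx_sign e (p / 2) -> 0 < a -> a <= b ->
  0 <= e * (b `^ (p - 2) - a `^ (p - 2)).
Proof.
move=> se a0 ab; have b0 : 0 < b by exact: lt_le_trans ab.
case: se => -[-> th].
- rewrite mul1r subr_ge0; apply: ge0_ler_powR => //;
    rewrite ?nnegrE ?(ltW a0) ?(ltW b0)//; lra.
- rewrite mulN1r opprB subr_ge0 (_ : p - 2 = - (2 - p)); last by ring.
  rewrite !powRN lef_pV2 ?posrE ?powR_gt0//.
  apply: ge0_ler_powR => //; rewrite ?nnegrE ?(ltW a0) ?(ltW b0)//; lra.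
Qed.

(** With q = p - 1, the difference of the two sides has derivative
    - q (1 + q) y ((1 + y)^(q - 1) - (1 - y)^(q - 1)), whose sign is known. *)
Lemma cvx_sign_trapezoid e p y : cvx_sign e (p / 2) -> 1 < p -> 0 <= y < 1 ->
  e * ((1 + y) `^ (p - 1) - (1 - y) `^ (p - 1)) <=
  e * ((p - 1) * y * ((1 + y) `^ (p - 1) + (1 - y) `^ (p - 1))).
Proof.
move=> se p1 /andP[y0 y1]; set q := p - 1; have q0 : 0 < q by rewrite /q; lra.
pose P x := (1 + 1 * x) `^ q; pose M x := (1 + (-1) * x) `^ q.
pose P' x := (1 + 1 * x) `^ (q - 1); pose M' x := (1 + (-1) * x) `^ (q - 1).
pose f x := e * (P x - M x) - e * q * (x * (P x + M x)).
have PE x : 0 <= x <= y -> P x = (1 + x) * P' x.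
  move=> xy; have x1 : 0 <= 1 + 1 * x by lra.
  by rewrite /P /P' -(mulr_powRB1 x1 q0) mul1r.
have ME x : 0 <= x <= y -> M x = (1 - x) * M' x.
  move=> xy; have x1 : 0 <= 1 + (-1) * x by lra.
  by rewrite /M /M' -(mulr_powRB1 x1 q0) mulN1r.
have := @derive_nonpos_le f (fun x => - (e * (q * (1 + q) * x) * (P' x - M' x))) y y0.
rewrite /f/= !mul0r mulr0 subr0 /P /M !mulr0 addr0 subrr mulr0 subr_le0.
rewrite mul1r mulN1r -!mulrA; apply => x xy.
- have dP : is_derive x 1 P (1 * (q * P' x)) by apply: is_derive_powR_shift; lra.
  have dM : is_derive x 1 M (-1 * (q * M' x)) by apply: is_derive_powR_shift; lra.
  have H := is_deriveB (is_deriveZ e (is_deriveB dP dM))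
    (is_deriveZ (e * q) (is_deriveM (is_derive_id x 1) (is_deriveD dP dM))).
  apply: (@is_derive_eq _ _ _ _ _ _ _ _ H).
  rewrite /GRing.scale/= -[(P + M) x]/(P x + M x).
  by rewrite (PE _ xy) (ME _ xy); ring.
- rewrite oppr_le0 (_ : e * _ * _ = q * (1 + q) * x * (e * (P' x - M' x))); last by ring.
  have x0 : 0 <= x by lra.
  apply: mulr_ge0; first by apply: mulr_ge0 => //; apply: mulr_ge0; lra.
  have := @cvx_sign_powR_mono e p (1 + (-1) * x) (1 + 1 * x) se.
  rewrite (_ : p - 2 = q - 1); last by rewrite /q; ring.
  by rewrite /P' /M'; apply; lra.
Qed.

(** The quotient ((1 + y)^p + (1 - y)^p) / (1 + (p - 1) y^2)^(p / 2) is monotone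
    on [0, 1), because its derivative has the sign found in the preceding
    lemma. *)
Lemma two_point_lt1 e p y : cvx_sign e (p / 2) -> 1 < p -> 0 <= y < 1 ->
  e * ((1 + y) `^ p + (1 - y) `^ p) <=
  e * (2 * (1 + (p - 1) * y ^+ 2) `^ (p / 2)).
Proof.
move=> se p1 /andP[y0 y1]; set q := p - 1; have q0 : 0 < q by rewrite /q; lra.
have p0 : 0 < p by lra.
have pq : p - 1 = q by [].
pose P x := (1 + 1 * x) `^ p; pose M x := (1 + (-1) * x) `^ p.
pose P' x := (1 + 1 * x) `^ (p - 1); pose M' x := (1 + (-1) * x) `^ (p - 1).
pose u x := 1 + q * (x * x).
have u0 x : 0 < u x by rewrite /u ltr_pwDl// mulr_ge0 -?expr2 ?sqr_ge0// ltW.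
pose W x := u x `^ (- (p / 2)); pose V x := u x `^ (- (p / 2) - 1).
have WE x : W x = u x * V x.
  rewrite /W /V powRB; last by rewrite lt0r_neq0 ?implybT.
  by rewrite (powRr1 (ltW (u0 x))) [RHS]mulrC divfK// lt0r_neq0.
have PE x : 0 <= x <= y -> P x = (1 + x) * P' x.
  move=> xy; have x1 : 0 <= 1 + 1 * x by lra.
  by rewrite /P /P' -(mulr_powRB1 x1 p0) mul1r.
have ME x : 0 <= x <= y -> M x = (1 - x) * M' x.
  move=> xy; have x1 : 0 <= 1 + (-1) * x by lra.
  by rewrite /M /M' -(mulr_powRB1 x1 p0) mulN1r.
pose f x := e * ((P x + M x) * W x).
have dW x : is_derive x 1 W (- (p / 2) * V x * (q * (2 * x))).
  have du : is_derive x 1 u (q * (2 * x)).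
    have H := is_deriveD (is_derive_cst (1 : R^o) (x : R^o) 1)
      (is_deriveZ q (is_deriveM (is_derive_id x 1) (is_derive_id x 1))).
    apply: (@is_derive_eq _ _ _ _ _ _ _ _ H).
    by rewrite add0r /GRing.scale/=; ring.
  exact: (is_derive1_comp (g := u) (f := fun z => z `^ (- (p / 2)))
    (is_derive1_powR _ (u0 x)) du).
have := @derive_nonpos_le f (fun x => e * (p * V x *
   ((P' x - M' x) - q * x * (P' x + M' x)))) y y0.
rewrite /f/= => H.
have {}H : f y <= f 0.
  apply: H => x xy.
  - have dP : is_derive x 1 P (1 * (p * P' x)) by apply: is_derive_powR_shift; lra.
    have dM : is_derive x 1 M (-1 * (p * M' x)) by apply: is_derive_powR_shift; lra.
    have H := is_deriveZ e (is_deriveM (is_deriveD dP dM) (dW x)).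
    apply: (@is_derive_eq _ _ _ _ _ _ _ _ H).
    rewrite /GRing.scale/= -[(P + M) x]/(P x + M x).
    by rewrite (PE _ xy) (ME _ xy) (WE x) /u; field.
  - rewrite mulrCA; apply: mulr_ge0_le0; first by rewrite mulr_ge0 ?powR_ge0// ltW.
    have xy1 : 0 <= x < 1 by lra.
    have := cvx_sign_trapezoid se p1 xy1; rewrite /P' /M' mul1r mulN1r -/q; lra.
move: H; rewrite /f /P /M /W /u !mulr0 !addr0 -expr2 !powR1 mulr1.
rewrite mul1r mulN1r powRN.
set Z := (1 + q * y ^+ 2) `^ (p / 2).
have Z0 : 0 < Z by rewrite powR_gt0//; exact: u0.
rewrite mulrA ler_pdivrMr// => /le_trans; apply.
by rewrite -mulrA.
Qed.

Lemma two_point_le1 e p y : cvx_sign e (p / 2) -> 1 < p -> 0 <= y <= 1 ->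
  e * (`|1 + y| `^ p + `|1 - y| `^ p) <=
  e * (2 * (1 + (p - 1) * y ^+ 2) `^ (p / 2)).
Proof.
move=> se p1 /andP[y0]; rewrite le_eqVlt => /orP[/eqP->{y y0}|y1]; last first.
  have y01 : 0 <= y < 1 by rewrite y0.
  have -> : `|1 + y| = 1 + y by rewrite ger0_norm//; lra.
  have -> : `|1 - y| = 1 - y by rewrite ger0_norm//; lra.
  exact: two_point_lt1.
have p0 : 0 < p by lra.
have p20 : 0 < p / 2 by lra.
pose f y := e * (`|1 + y| `^ p + `|1 - y| `^ p) -
  e * (2 * (1 + (p - 1) * y ^+ 2) `^ (p / 2)).
have cf : continuous f.
  move=> y.
  have c1 : {for y, continuous (fun y => `|1 + y| `^ p)}.
    apply: (@continuous_powR_ge0 _ (fun y => `|1 + y|)) => //.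
    by apply: cvg_norm; apply: cvgD; [exact: cvg_cst|exact: cvg_id].
  have c2 : {for y, continuous (fun y => `|1 - y| `^ p)}.
    apply: (@continuous_powR_ge0 _ (fun y => `|1 - y|)) => //.
    by apply: cvg_norm; apply: cvgB; [exact: cvg_cst|exact: cvg_id].
  have c3 : {for y, continuous (fun y => (1 + (p - 1) * y ^+ 2) `^ (p / 2))}.
    apply: (@continuous_powR_ge0 _ (fun y => 1 + (p - 1) * y ^+ 2)) => // [x|].
      by rewrite addr_ge0// mulr_ge0 ?sqr_ge0// subr_ge0 ltW.
    apply: cvgD; first exact: cvg_cst.
    by apply: cvgM; [exact: cvg_cst|exact: exprn_continuous].
  apply: cvgB; apply: cvgM; try exact: cvg_cst.
    by apply: cvgD; [exact: c1|exact: c2].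
  by apply: cvgM; [exact: cvg_cst|exact: c3].
rewrite -subr_le0 -/(f 1) leNgt; apply/negP => f1.
have /cvgrPdist_lt/(_ _ f1)/nbhs_ballP[d /= d0 dP] := cf 1.
pose m := Num.min (d / 2) (2^-1).
have m0 : 0 < m by rewrite lt_min invr_gt0 ltr0n divr_gt0.
have m1 : m <= 2^-1 by rewrite ge_min lexx orbT.
have m2 : m <= d / 2 by rewrite ge_min lexx.
have := dP (1 - m); rewrite /ball/= subKr gtr0_norm// => /(_ _).
have -> : m < d by lra.
move=> /(_ isT); rewrite ltr_norml => /andP[_ H].
have y01 : 0 <= 1 - m < 1 by lra.
have := two_point_lt1 se p1 y01.
have E1 : `|1 + (1 - m)| = 1 + (1 - m) by rewrite ger0_norm//; lra.
have E2 : `|1 - (1 - m)| = 1 - (1 - m) by rewrite ger0_norm//; lra.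
rewrite -{1}E1 -{1}E2 -subr_le0 -/(f (1 - m)); lra.
Qed.

(** By homogeneity the larger of x and y may be taken to be 1.  If it is y, then
    exchanging x and y moves the right-hand side in the favourable direction. *)
Lemma two_point e p x y : cvx_sign e (p / 2) -> 1 < p -> 0 <= x -> 0 <= y ->
  e * (`|x + y| `^ p + `|x - y| `^ p) <=
  e * (2 * (x ^+ 2 + (p - 1) * y ^+ 2) `^ (p / 2)).
Proof.
move=> se p1; have p0 : 0 < p by lra.
have pn0 : p != 0 by rewrite lt0r_neq0.
have p2n0 : p / 2 != 0 by rewrite lt0r_neq0//; lra.
have base u v : 0 <= v -> v <= u -> e * (`|u + v| `^ p + `|u - v| `^ p) <=
    e * (2 * (u ^+ 2 + (p - 1) * v ^+ 2) `^ (p / 2)).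
  move=> v0 vu; have [u0|un0] := eqVneq u 0.
    have -> : v = 0 by lra.
    by rewrite u0 addr0 subr0 normr0 expr0n/= mulr0 addr0 !powR0// addr0 !mulr0.
  have up : 0 < u by rewrite lt_def un0 (le_trans v0).
  have y01 : 0 <= v / u <= 1 by rewrite divr_ge0 ?(ltW up)//= ler_pdivrMr// mul1r.
  have := two_point_le1 se p1 y01.
  have -> : `|u + v| `^ p = u `^ p * `|1 + v / u| `^ p.
    rewrite -powRM ?(ltW up)//; congr (_ `^ _).
    by rewrite -{2}(gtr0_norm up) -normrM mulrDr mulr1 mulrC divfK.
  have -> : `|u - v| `^ p = u `^ p * `|1 - v / u| `^ p.
    rewrite -powRM ?(ltW up)//; congr (_ `^ _).
    by rewrite -{2}(gtr0_norm up) -normrM mulrBr mulr1 mulrC divfK.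
  have -> : (u ^+ 2 + (p - 1) * v ^+ 2) `^ (p / 2) =
      u `^ p * (1 + (p - 1) * (v / u) ^+ 2) `^ (p / 2).
    have -> : u `^ p = (u ^+ 2) `^ (p / 2).
      rewrite -powR_mulrn ?(ltW up)// -powRrM; by congr (_ `^ _); field.
    rewrite -powRM ?sqr_ge0//.
      by congr (_ `^ _); field.
    by rewrite addr_ge0// mulr_ge0 ?sqr_ge0// subr_ge0 ltW.
  move=> /(ler_wpM2l (powR_ge0 u p)); set X := _ `^ p; set Y := _ `^ p;
    set Z := _ `^ p; set W := _ `^ (p / 2); lra.
move=> x0 y0; have [yx|/ltW xy] := leP y x; first exact: base.
rewrite (addrC x) (distrC x); apply: le_trans (base _ _ x0 xy) _.
rewrite mulrCA [leRHS]mulrCA ler_pM2l//; apply: (ler_cvx_sign se).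
- by lra.
- by rewrite addr_ge0 ?sqr_ge0// mulr_ge0 ?sqr_ge0// subr_ge0 ltW.
- by rewrite addr_ge0 ?sqr_ge0// mulr_ge0 ?sqr_ge0// subr_ge0 ltW.
have sq : x ^+ 2 <= y ^+ 2 by rewrite ler_pXn2r.
rewrite -subr_ge0.
have -> : e * (x ^+ 2 + (p - 1) * y ^+ 2) - e * (y ^+ 2 + (p - 1) * x ^+ 2) =
  e * (p - 2) * (y ^+ 2 - x ^+ 2) by ring.
apply: mulr_ge0; last by rewrite subr_ge0.
by case: se => -[-> ?]; lra.
Qed.

Implicit Types (c d : R[i]).

Lemma normc_powR p c : normc c `^ p = (normc c ^+ 2) `^ (p / 2).
Proof.
by rewrite -powR_mulrn ?normc_ge0// -powRrM; congr (_ `^ _); field.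
Qed.

Lemma normc_sqrD c d : normc (c + d) ^+ 2 =
  normc c ^+ 2 + normc d ^+ 2 + 2 * (Re c * Re d + Im c * Im d).
Proof. by rewrite !normc_sqr ReD ImD; ring. Qed.

Lemma normc_sqrB c d : normc (c - d) ^+ 2 =
  normc c ^+ 2 + normc d ^+ 2 - 2 * (Re c * Re d + Im c * Im d).
Proof. by rewrite !normc_sqr ReD ImD ReN ImN; ring. Qed.

(** The numbers |c + d|^2 and |c - d|^2 have mean |c|^2 + |d|^2; convexity and
    superadditivity of the power p / 2 give the two steps. *)
Lemma clarkson_pointwise e p c d : cvx_sign e (p / 2) ->
  e * (2 * normc c `^ p + 2 * normc d `^ p) <=
  e * (normc (c + d) `^ p + normc (c - d) `^ p).
Proof.
move=> se; rewrite !(normc_powR p); have cv := cvx_sign_convex se.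
have z : e * 0 `^ (p / 2) = 0 by rewrite powR0 ?mulr0// lt0r_neq0 ?(cvx_sign_gt0 se).
have := convex_superadd cv z (sqr_ge0 (normc c)) (sqr_ge0 (normc d)).
have := convex_midpoint cv (sqr_ge0 (normc (c + d))) (sqr_ge0 (normc (c - d))).
have -> : (normc (c + d) ^+ 2 + normc (c - d) ^+ 2) / 2 =
    normc c ^+ 2 + normc d ^+ 2 by rewrite normc_sqrD normc_sqrB; field.
lra.
Qed.

(** The numbers |c + d|^2 and |c - d|^2 lie symmetrically about |c|^2 + |d|^2, at
    distance at most 2 |c| |d|.  Spreading them to this distance reduces the
    claim to the real two-point inequality. *)
Lemma ball_carlen_lieb_pointwise e p c d : cvx_sign e (p / 2) -> 1 < p ->
  e * (normc (c + d) `^ p + normc (c - d) `^ p) <=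
  e * (2 * (normc c ^+ 2 + (p - 1) * normc d ^+ 2) `^ (p / 2)).
Proof.
move=> se p1; have cv := cvx_sign_convex se.
apply: le_trans (two_point se p1 (normc_ge0 c) (normc_ge0 d)).
set x := normc c; set y := normc d.
have nn z : `|z| `^ p = (z ^+ 2) `^ (p / 2).
  rewrite -real_normK ?num_real// -powR_mulrn// -powRrM.
  by congr (_ `^ _); field.
rewrite !nn !(normc_powR p) normc_sqrD normc_sqrB -/x -/y.
have -> : (x + y) ^+ 2 = x ^+ 2 + y ^+ 2 + 2 * (x * y) by ring.
have -> : (x - y) ^+ 2 = x ^+ 2 + y ^+ 2 - 2 * (x * y) by ring.
rewrite mulrDr [leRHS]mulrDr; apply: (convex_spread cv).
  rewrite normrM ger0_norm// ler_pM2l//.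
  rewrite -(@ler_pXn2r _ 2%N) ?nnegrE ?mulr_ge0 ?normc_ge0//.
  rewrite real_normK ?num_real// exprMn /x /y !normc_sqr -subr_ge0.
  have -> : (Re c ^+ 2 + Im c ^+ 2) * (Re d ^+ 2 + Im d ^+ 2) -
    (Re c * Re d + Im c * Im d) ^+ 2 = (Re c * Im d - Im c * Re d) ^+ 2 by ring.
  exact: sqr_ge0.
have := sqr_ge0 (x - y); rewrite sqrrB; lra.
Qed.
End TwoPoint.

(** * From parallelogram inequalities to orthogonality *)

Section Iteration.
Variable R : realType.
Implicit Types (D g : R -> R).

(** The infimum m of D over t > 0 satisfies c m <= m. *)
Lemma contraction_ge0 D (c M : R) : c < 1 ->
  (forall t, 0 < t -> c * D (t / 2) <= D t) ->
  (forall t, 0 < t -> M <= D t) -> 0 <= c -> 0 <= D 1.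
Proof.
move=> c1 Dc DM c0.
pose E := [set D t | t in [set t : R | 0 < t]].
have Elb : has_lbound E by exists M => _ [t /= t0 <-]; exact: DM.
have E1 : E (D 1) by exists 1 => //=; exact: ltr01.
have inf_le t : 0 < t -> inf E <= D t by move=> t0; apply: ge_inf => //; exists t.
have : c * inf E <= inf E.
  apply: lb_le_inf; first by exists (D 1).
  move=> _ [t /= t0 <-]; rewrite (le_trans _ (Dc t t0))//.
  by rewrite ler_wpM2l// inf_le// divr_gt0.
have := inf_le 1 ltr01; set m := inf E => mD cm.
have : 0 <= (1 - c) * m by lra.
by rewrite pmulr_rge0 ?subr_gt0//; lra.
Qed.

(** Let psi t = (g t - g 0) / t ^ ex and K = k / (2 ^ (ex - 1) - 1).  The last
    hypothesis compares 2 ^ ex psi (2 t) with 2 psi t + 2 k B, and K B is the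
    fixed point of this recursion; the others bound psi from below by 0 and, if
    e = - 1, from above by 2 k B.  So e (psi - K B) falls under the
    contraction argument. *)
Lemma pythagoras_iter g (e ex k B : R) : e = 1 \/ e = -1 -> 1 < ex -> 0 <= k ->
  0 <= B -> (forall t, g 0 <= g t) ->
  (forall t, 0 < t -> e * (2 * g 0 + 2 * k * t `^ ex * B) <= e * (g t + g (- t))) ->
  (forall t, 0 < t ->
    e * (2 * g t + 2 * k * t `^ ex * B) <= e * (g (2 * t) + g 0)) ->
  0 <= e * (g 1 - g 0 - k / (2 `^ (ex - 1) - 1) * B).
Proof.
move=> e1 ex1 k0 B0 g0 H2 H1.
set K := k / _.
have two : 1 < 2 `^ (ex - 1) :> R.
  rewrite -[ltLHS](powRr0 2) /powR pnatr_eq0/= ltr_expR ltr_pM2r ?ln_gt0 ?ltr1n//.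
  by lra.
have K0 : 0 <= K by rewrite divr_ge0// subr_ge0 ltW.
pose c : R := 2 / 2 `^ ex.
have tex : 2 `^ ex = 2 * 2 `^ (ex - 1) :> R by rewrite mulr_powRB1//; lra.
have p2 : 0 < 2 `^ ex :> R by rewrite powR_gt0.
have c0 : 0 <= c by rewrite divr_ge0// ltW.
have c1 : c < 1 by rewrite ltr_pdivrMr// tex; lra.
(* K B is the fixed point of psi |-> c (psi + k B). *)
have Kc : K = c * (K + k).
  by rewrite /K /c tex; field; lra.
pose D t := e * ((g t - g 0) / t `^ ex - K * B).
have -> : e * (g 1 - g 0 - K * B) = D 1 by rewrite /D powR1 divr1.
apply: (@contraction_ge0 D c (- (2 * k + K) * B) c1) => // t t0.
  have t20 : 0 < t / 2 by rewrite divr_gt0.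
  have T0 : 0 < (t / 2) `^ ex by rewrite powR_gt0.
  have tE : t `^ ex = 2 `^ ex * (t / 2) `^ ex.
    by rewrite -powRM ?(ltW t20)// mulrC divfK.
  have := H1 _ t20; rewrite [2 * (t / 2)]mulrC divfK//.
  rewrite /D; set G := g t; set G2 := g (t / 2); set G0 := g 0 => H.
  rewrite tE -subr_ge0; set S := (t / 2) `^ ex in T0 H *.
  have -> : e * ((G - G0) / (2 `^ ex * S) - K * B) -
      c * (e * ((G2 - G0) / S - K * B)) =
      (2 `^ ex * S)^-1 * (e * (G + G0) - e * (2 * G2 + 2 * k * S * B)).
    by rewrite {1}Kc /c; field; rewrite !lt0r_neq0.
  by rewrite mulr_ge0 ?subr_ge0// invr_ge0 mulr_ge0// ltW.
have T0 : 0 < t `^ ex by rewrite powR_gt0.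
have KB : 0 <= K * B by rewrite mulr_ge0.
have kB : 0 <= k * B by rewrite mulr_ge0.
have gt := g0 t; have gmt := g0 (- t).
rewrite /D; case: e1 => e1; have := H2 _ t0; rewrite e1 ?mul1r ?mulN1r => H.
  have : 0 <= (g t - g 0) / t `^ ex by rewrite divr_ge0 ?subr_ge0// ltW.
  lra.
have : (g t - g 0) / t `^ ex <= 2 * k * B by rewrite ler_pdivrMr//; lra.
lra.
Qed.

(** The upper bound makes g differentiable at 0, with derivative 0 at its
    minimum. *)
Lemma no_linear_growth g (ex C : R) : 1 < ex -> 0 <= C -> (forall t, g 0 <= g t) ->
  (forall t, 0 < t -> g t + g (- t) <= 2 * g 0 + C * t `^ ex) ->
  (forall t, 0 < t -> g 0 + t <= g (- t)) -> False.
Proof.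
move=> ex1 C0 g0 H1 H2.
(* With t ^ (ex - 1) = 1 / (C + 1) the upper bound C t ^ ex is less than t. *)
pose b : R := (C + 1)^-1.
have b0 : 0 < b by rewrite invr_gt0 ltr_wpDl.
pose t : R := b `^ (ex - 1)^-1.
have t0 : 0 < t by rewrite powR_gt0.
have tb : t `^ (ex - 1) = b.
  by rewrite /t -powRrM mulVf ?powRr1 ?(ltW b0)// lt0r_neq0// subr_gt0.
have ex0 : 0 < ex by lra.
have := H1 _ t0; have := H2 _ t0; have := g0 t.
rewrite -(mulr_powRB1 (ltW t0) ex0) tb => h1 h2 h3.
have : t <= C * (t * b) by lra.
rewrite mulrCA ler_pMr// /b ler_pdivlMr ?ltr_wpDl//; lra.
Qed.

End Iteration.

(** * Parallelogram and Pythagorean inequalities for the Hardy norm *)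

Lemma cvx_sign_leP (R : realType) (e theta : R) : cvx_sign e theta ->
  (e = 1 -> forall x y, e * x <= e * y <-> x <= y) /\
  (e = -1 -> forall x y, e * x <= e * y <-> y <= x).
Proof.
by move=> _; split => -> x y; rewrite ?mul1r ?mulN1r ?lerN2.
Qed.

Section HardyGeometry.
Variable R : realType.
Variables (p e : R).
Hypothesis p1 : 1 < p.
Hypothesis se : cvx_sign e (p / 2).
Implicit Types (u v : R[i] -> R[i]).

Notation N g := (hardy_norm p g).

Lemma hardy_lin_side u1 u2 v1 v2 (a1 a2 b1 b2 : R) :
  Hardy p u1 -> Hardy p u2 -> Hardy p v1 -> Hardy p v2 ->
  0 <= a1 -> 0 <= a2 -> 0 <= b1 -> 0 <= b2 ->
  (forall z, e * (a1 * normc (u1 z) `^ p + a2 * normc (u2 z) `^ p) <=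
    e * (b1 * normc (v1 z) `^ p + b2 * normc (v2 z) `^ p)) ->
  e * (a1 * N u1 `^ p + a2 * N u2 `^ p) <= e * (b1 * N v1 `^ p + b2 * N v2 `^ p).
Proof.
move=> hu1 hu2 hv1 hv2 a10 a20 b10 b20 H.
have [pos neg] := cvx_sign_leP se.
case: (se) => -[e1 _].
- by apply/(pos e1)/(hardy_lin p1 hu1 hu2 hv1 hv2 a10 a20 b10 b20) => z _;
    exact/(pos e1).
- by apply/(neg e1)/(hardy_lin p1 hv1 hv2 hu1 hu2 b10 b20 a10 a20) => z _;
    exact/(neg e1).
Qed.

Section Pair.
Variables (u v s d : R[i] -> R[i]).
Hypotheses (hu : Hardy p u) (hv : Hardy p v) (hs : Hardy p s) (hd : Hardy p d).
Hypothesis sE : forall z, s z = u z + v z.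
Hypothesis dE : forall z, d z = u z - v z.

Lemma hardy_clarkson :
  e * (2 * N u `^ p + 2 * N v `^ p) <=
  e * (N s `^ p + N d `^ p).
Proof.
have n2 : 0 <= 2 :> R by rewrite ler0n.
have n1 : 0 <= 1 :> R by exact: ler01.
have pw z : e * (2 * normc (u z) `^ p + 2 * normc (v z) `^ p) <=
    e * (1 * normc (s z) `^ p + 1 * normc (d z) `^ p).
  by rewrite !mul1r sE dE; exact: clarkson_pointwise.
have := @hardy_lin_side u v s d 2 2 1 1 hu hv hs hd n2 n2 n1 n1 pw.
by move: (N s) (N d) (N u) (N v) => ns nd nu nv; rewrite !mul1r.
Qed.

(** For a fixed weight l the inequality is linear in the p-th powers, so it
    passes from complex numbers to the norms. *)
Lemma hardy_ball_carlen_lieb_weighted l : 0 < l < 1 ->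
  e * (N s `^ p + N d `^ p) <=
  2 * (l `^ (1 - p / 2) * (e * N u `^ p) +
    (1 - l) `^ (1 - p / 2) * (e * ((p - 1) `^ (p / 2) * N v `^ p))).
Proof.
move=> l01; have pm0 : 0 <= p - 1 by rewrite subr_ge0 ltW.
pose A := l `^ (1 - p / 2); pose B := (1 - l) `^ (1 - p / 2) * (p - 1) `^ (p / 2).
have A20 : 0 <= 2 * A by rewrite mulr_ge0 ?powR_ge0.
have B20 : 0 <= 2 * B by rewrite !mulr_ge0 ?powR_ge0.
have n1 : 0 <= 1 :> R by exact: ler01.
have E x y : e * (2 * A * x + 2 * B * y) = 2 * (l `^ (1 - p / 2) * (e * x) +
      (1 - l) `^ (1 - p / 2) * (e * ((p - 1) `^ (p / 2) * y))).
  by rewrite /A /B; ring.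
have pw z : e * (1 * normc (s z) `^ p + 1 * normc (d z) `^ p) <=
    e * (2 * A * normc (u z) `^ p + 2 * B * normc (v z) `^ p).
  rewrite !mul1r sE dE.
  apply: le_trans (ball_carlen_lieb_pointwise _ _ se p1) _.
  have := cvx_sign_hoelder se l01 (sqr_ge0 (normc (u z)))
    (mulr_ge0 pm0 (sqr_ge0 (normc (v z)))).
  rewrite (powRM _ pm0 (sqr_ge0 _)) -!normc_powR => H.
  by rewrite E [leLHS]mulrCA ler_pM2l.
clearbody A B.
have := @hardy_lin_side s d u v 1 1 (2 * A) (2 * B) hs hd hu hv n1 n1 A20 B20 pw.
move: (N s) (N d) (N u) (N v) => ns nd nu nv.
by rewrite -E !mul1r.
Qed.

(** The best weight gives the inequality with p-th powers on the left; the power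
    mean inequality then compares exponents p and 2. *)
Lemma hardy_ball_carlen_lieb :
  e * (N s ^+ 2 + N d ^+ 2) <= e * (2 * N u ^+ 2 + 2 * (p - 1) * N v ^+ 2).
Proof.
have := hardy_ball_carlen_lieb_weighted.
have := hardy_norm_ge0 p s; have := hardy_norm_ge0 p d.
have := hardy_norm_ge0 p u; have := hardy_norm_ge0 p v.
move: (N s) (N d) (N u) (N v) => X Y U V V0 U0 Y0 X0 H.
have pm0 : 0 <= p - 1 by rewrite subr_ge0 ltW.
have p20 : 0 < p / 2 by exact: cvx_sign_gt0 se.
have sq W : 0 <= W -> W `^ p = (W ^+ 2) `^ (p / 2).
  move=> W0; rewrite -powR_mulrn// -powRrM.
  by congr (_ `^ _); field.
have {}H : e * ((X `^ p + Y `^ p) / 2) <= e * (U ^+ 2 + (p - 1) * V ^+ 2) `^ (p / 2).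
  apply: (cvx_sign_le_sum_powR se); rewrite ?mulr_ge0 ?sqr_ge0// => l l01.
  by have := H l l01; rewrite (powRM _ pm0 (sqr_ge0 V)) (sq U)// (sq V)//; lra.
have sV := cvx_signV se.
have root W : 0 <= W -> (W `^ p) `^ (p / 2)^-1 = W ^+ 2.
  move=> W0; rewrite -powRrM -powR_mulrn//; congr (_ `^ _).
  by field; lra.
have mid := convex_midpoint (cvx_sign_convex sV) (powR_ge0 X p) (powR_ge0 Y p).
rewrite !root// in mid.
have Z0 : 0 <= U ^+ 2 + (p - 1) * V ^+ 2.
  by rewrite addr_ge0 ?sqr_ge0// mulr_ge0 ?sqr_ge0.
have XY0 : 0 <= (X `^ p + Y `^ p) / 2 by rewrite divr_ge0// addr_ge0 ?powR_ge0.
have ip20 : 0 <= (p / 2)^-1 by rewrite invr_ge0 ltW.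
have := ler_cvx_sign se ip20 XY0 (powR_ge0 _ _) H.
rewrite -powRrM divff ?lt0r_neq0// powRr1//.
move: mid; set r := _ `^ (p / 2)^-1; lra.
Qed.

End Pair.
End HardyGeometry.

Section Pythagoras.
Variable R : realType.
Variables (p e : R).
Hypothesis p1 : 1 < p.
Hypothesis se : cvx_sign e (p / 2).

Notation N g := (hardy_norm p g).

Lemma hardy_norm_scale c (g : R[i] -> R[i]) : Hardy p g ->
  Hardy p (fun z => c * g z) -> N (fun z => c * g z) = normc c * N g.
Proof.
move=> hg hcg; have E := hardy_normZ p1 hg hcg.
have := hardy_norm_ge0 p (fun z => c * g z); have := hardy_norm_ge0 p g.
move: E; move: (N g) (N _) => n m E n0 m0.
have {}E : m `^ p = (normc c * n) `^ p by rewrite powRM// normc_ge0.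
have cn : 0 <= normc c * n by rewrite mulr_ge0 ?normc_ge0.
apply/le_anti/andP; split.
- by apply: (powR_ler_cancel p1 m0 cn); rewrite E.
- by apply: (powR_ler_cancel p1 cn m0); rewrite E.
Qed.

Section Line.
Variables (X : R -> R[i] -> R[i]) (y : R[i] -> R[i]).
Hypothesis XE : forall s t z, X (s + t) z = X s z + t%:C * y z.
Hypothesis hX : forall t, Hardy p (X t).
Hypothesis hy : Hardy p y.
Hypothesis hty : forall t : R, Hardy p (fun z => t%:C * y z).

Let direction t : 0 < t -> exists ty, [/\ forall z, ty z = t%:C * y z,
  Hardy p ty & N ty = t * N y].
Proof.
move=> t0; exists (fun z => t%:C * y z); split; [by []|exact: hty|].
by rewrite (hardy_norm_scale hy (hty t)) normc_real gtr0_norm.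
Qed.

Lemma hardy_line_clarkson s t : 0 < t ->
  e * (2 * N (X s) `^ p + 2 * (t `^ p * N y `^ p)) <=
  e * (N (X (s + t)) `^ p + N (X (s - t)) `^ p).
Proof.
move=> t0; have [ty [tyE hty' nE]] := direction t0.
have add z : X (s + t) z = X s z + ty z by rewrite XE tyE.
have sub z : X (s - t) z = X s z - ty z by rewrite XE tyE rmorphN mulNr.
have := @hardy_clarkson _ p e p1 se (X s) ty (X (s + t)) (X (s - t))
  (hX s) hty' (hX _) (hX _) add sub.
by rewrite nE powRM ?hardy_norm_ge0// ltW.
Qed.

Lemma hardy_line_ball_carlen_lieb s t : 0 < t ->
  e * (N (X (s + t)) ^+ 2 + N (X (s - t)) ^+ 2) <=
  e * (2 * N (X s) ^+ 2 + 2 * (p - 1) * (t ^+ 2 * N y ^+ 2)).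
Proof.
move=> t0; have [ty [tyE hty' nE]] := direction t0.
have add z : X (s + t) z = X s z + ty z by rewrite XE tyE.
have sub z : X (s - t) z = X s z - ty z by rewrite XE tyE rmorphN mulNr.
have := @hardy_ball_carlen_lieb _ p e p1 se (X s) ty (X (s + t)) (X (s - t))
  (hX s) hty' (hX _) (hX _) add sub.
by rewrite nE exprMn.
Qed.

Hypothesis orth : forall t, N (X 0) <= N (X t).

Let clarkson2 t : 0 < t ->
  e * (2 * N (X t) `^ p + 2 * 1 * t `^ p * N y `^ p) <=
  e * (N (X (2 * t)) `^ p + N (X 0) `^ p).
Proof.
move=> t0; have := hardy_line_clarkson t t0.
have -> : t + t = 2 * t by ring.
rewrite subrr.
by move: (N (X t)) (N (X (2 * t))) (N (X 0)) (N y) => a b c n; lra.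
Qed.

Let clarkson0 t : 0 < t ->
  e * (2 * N (X 0) `^ p + 2 * 1 * t `^ p * N y `^ p) <=
  e * (N (X t) `^ p + N (X (- t)) `^ p).
Proof.
move=> t0; have := hardy_line_clarkson 0 t0.
rewrite add0r sub0r.
by move: (N (X t)) (N (X (- t))) (N (X 0)) (N y) => a b c n; lra.
Qed.

Let smooth2 t : 0 < t ->
  - e * (2 * N (X t) ^+ 2 + 2 * (p - 1) * t `^ 2 * N y ^+ 2) <=
  - e * (N (X (2 * t)) ^+ 2 + N (X 0) ^+ 2).
Proof.
move=> t0; have := hardy_line_ball_carlen_lieb t t0.
have -> : t + t = 2 * t by ring.
rewrite subrr powR_mulrn ?(ltW t0)//.
by move: (N (X t)) (N (X (2 * t))) (N (X 0)) (N y) => a b c n; lra.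
Qed.

Let smooth0 t : 0 < t ->
  - e * (2 * N (X 0) ^+ 2 + 2 * (p - 1) * t `^ 2 * N y ^+ 2) <=
  - e * (N (X t) ^+ 2 + N (X (- t)) ^+ 2).
Proof.
move=> t0; have := hardy_line_ball_carlen_lieb 0 t0.
rewrite add0r sub0r powR_mulrn ?(ltW t0)//.
by move: (N (X t)) (N (X (- t))) (N (X 0)) (N y) => a b c n; lra.
Qed.

Let e1 : e = 1 \/ e = -1.
Proof. by case: se => -[]; [left|right]. Qed.

Let orthp t : N (X 0) `^ p <= N (X t) `^ p.
Proof. by apply: (ler_powR_base p1); [exact: hardy_norm_ge0|exact: orth]. Qed.

Let orth2 t : N (X 0) ^+ 2 <= N (X t) ^+ 2.
Proof.
by rewrite ler_pXn2r// ?nnegrE ?hardy_norm_ge0//; exact: orth.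
Qed.

Lemma hardy_pythagoras_pow :
  0 <= e * (N (X 1) `^ p - N (X 0) `^ p - (2 `^ (p - 1) - 1)^-1 * N y `^ p).
Proof.
have := @pythagoras_iter _ (fun t => N (X t) `^ p) e p 1 (N y `^ p) e1 p1 ler01
  (powR_ge0 _ _) orthp clarkson0 clarkson2.
by rewrite mul1r.
Qed.

Lemma hardy_pythagoras_sqr :
  0 <= - e * (N (X 1) ^+ 2 - N (X 0) ^+ 2 - (p - 1) * N y ^+ 2).
Proof.
have e1' : - e = 1 \/ - e = -1 by case: e1 => ->; [right|left; rewrite opprK].
have pm0 : 0 <= p - 1 by rewrite subr_ge0 ltW.
have := @pythagoras_iter _ (fun t => N (X t) ^+ 2) (- e) 2 (p - 1) (N y ^+ 2) e1'
  (ltr1n _ 2) pm0 (sqr_ge0 _) orth2 smooth0 smooth2.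
have -> : 2 `^ (2 - 1) - 1 = 1 :> R.
  have -> : 2 - 1 = 1 :> R by ring.
  by rewrite powRr1//; ring.
by rewrite divr1.
Qed.

Lemma hardy_no_linear_growth : N (X 0) = 1 ->
  (forall t, 0 < t -> 1 + t <= N (X (- t))) -> False.
Proof.
move=> X0 H; case: se => -[ee _].
- apply: (@no_linear_growth _ (fun t => N (X t) ^+ 2) 2
    (2 * (p - 1) * N y ^+ 2)) => [|||t t0|t t0].
  + by rewrite ltr1n.
  + by rewrite mulr_ge0 ?sqr_ge0// mulr_ge0// subr_ge0 ltW.
  + exact: orth2.
  + have := smooth0 t0; rewrite ee.
    by move: (N (X t)) (N (X (- t))) (N (X 0)) (N y) => a b c n; lra.
  + rewrite X0 expr1n; have := H t t0; move: (N _) => n n1.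
    have d0 : 0 <= n - (1 + t) by rewrite subr_ge0.
    have s0 : 0 <= n + (1 + t) by lra.
    by have := mulr_ge0 d0 s0; have := sqr_ge0 t; lra.
- apply: (@no_linear_growth _ (fun t => N (X t) `^ p) p
    (2 * N y `^ p)) => [|||t t0|t t0].
  + exact: p1.
  + by rewrite mulr_ge0 ?powR_ge0.
  + exact: orthp.
  + have := clarkson0 t0; rewrite ee.
    by move: (N (X t)) (N (X (- t))) (N (X 0)) (N y) => a b c n; lra.
  + rewrite X0 powR1; have n1 := H t t0.
    have t1 : 1 <= 1 + t by rewrite lerDl ltW.
    apply: (le_trans (le1r_powR t1 (ltW p1))); apply: (ler_powR_base p1) => //.
    by rewrite (le_trans ler01).
Qed.

End Line.
End Pythagoras.

(** * Optimal linear approximants *)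

Section Final.
Variable R : realType.
Implicit Types (p : R) (f : R[i] -> R[i]).

Lemma le_powR_root (x r C D : R) : 0 <= x -> 0 < r -> 0 < C -> C * x `^ r <= D ->
  x <= (D / C) `^ (1 / r).
Proof.
move=> x0 r0 C0 H.
have {1}-> : x = (x `^ r) `^ (1 / r).
  by rewrite -powRrM mul1r mulfV ?powRr1// lt0r_neq0.
have le : x `^ r <= D / C by rewrite ler_pdivlMr// mulrC.
apply: ge0_ler_powR => //; rewrite ?nnegrE ?powR_ge0//.
  by rewrite divr_ge0// ltW.
by rewrite (le_trans (powR_ge0 _ _) le).
Qed.

Lemma powR_root_le (x r C D : R) : 0 <= x -> 0 < r -> 0 < C -> 0 <= D ->
  D <= C * x `^ r -> (D / C) `^ (1 / r) <= x.
Proof.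
move=> x0 r0 C0 D0 H.
have {1}-> : x = (x `^ r) `^ (1 / r).
  by rewrite -powRrM mul1r mulfV ?powRr1// lt0r_neq0.
have le : D / C <= x `^ r by rewrite ler_pdivrMr// mulrC.
apply: ge0_ler_powR => //; rewrite ?nnegrE ?powR_ge0//.
  by rewrite divr_ge0// ltW.
by rewrite divr_ge0// ltW.
Qed.

Lemma hardy_linear p f (b c d : R[i]) : 1 < p -> Hardy p f ->
  Hardy p (fun z => (b * z + c) * f z + d).
Proof.
move=> p1 hf; apply: (@hardy_affine _ _ p1 f (fun z => b * z + c) (normc b + normc c)) => //.
- move=> z _; apply: hol_atD; last exact: hol_at_cst.
  by apply: hol_atM; [exact: hol_at_cst|exact: hol_at_id].
- move=> z z1; rewrite (le_trans (ler_normcD _ _))// lerD2r normcM.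
  by rewrite ler_piMr ?normc_ge0// ltW.
Qed.

Section Opa.
Variables (p : R) (f : R[i] -> R[i]) (a w : R[i]).
Hypotheses (p1 : 1 < p) (hf : Hardy p f).
Let Q : {poly R[i]} := a *: ('X - w%:P).
Hypothesis hopa : is_opa 1 p f Q.

Notation N g := (hardy_norm p g).

(** The line through Q f - 1 in the direction d f, with Q = a ('X - w%:P).  For
    d = a w it passes at time 1 through a z f - 1. *)
Definition opa_line (d : R[i]) (t : R) (z : R[i]) : R[i] :=
  (a * (z - w) + t%:C * d) * f z - 1.

Lemma opa_lineD d s t z :
  opa_line d (s + t) z = opa_line d s z + t%:C * (d * f z).
Proof. by rewrite /opa_line rmorphD/=; ring. Qed.

Lemma hardy_opa_line d t : Hardy p (opa_line d t).
Proof.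
have -> : opa_line d t = (fun z => (a * z + (t%:C * d - a * w)) * f z + -1).
  by apply/funext => z; rewrite /opa_line; ring.
exact: hardy_linear.
Qed.

Lemma hardy_scale c : Hardy p (fun z => c * f z).
Proof.
have -> : (fun z => c * f z) = (fun z => (0 * z + c) * f z + 0).
  by apply/funext => z; ring.
exact: hardy_linear.
Qed.

Lemma horner_Q z : Q.[z] = a * (z - w).
Proof. by rewrite /Q hornerZ hornerXsubC. Qed.

(** The polynomial Q + t d competes with Q. *)
Lemma opa_orth d t : N (opa_line d 0) <= N (opa_line d t).
Proof.
pose r t : {poly R[i]} := Q + (t%:C * d)%:P.
have size2 s : (size (r s) <= 2)%N.
  rewrite (leq_trans (size_polyD _ _))// geq_max; apply/andP; split.
    by rewrite (leq_trans (size_scale_leq _ _))// size_XsubC.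
  by rewrite (leq_trans (size_polyC_leq1 _)).
have flip s : (fun z => 1 - (r s).[z] * f z) = (fun z => -1 * opa_line d s z).
  by apply/funext => z; rewrite hornerD hornerC horner_Q /opa_line; ring.
have hflip s : Hardy p (fun z => 1 - (r s).[z] * f z).
  have -> : (fun z => 1 - (r s).[z] * f z) =
      (fun z => (- a * z + (a * w - s%:C * d)) * f z + 1).
    by apply/funext => z; rewrite hornerD hornerC horner_Q; ring.
  exact: hardy_linear.
have nflip s : N (fun z => 1 - (r s).[z] * f z) = N (opa_line d s).
  have := hflip s; rewrite flip => h.
  rewrite (hardy_norm_scale p1 (hardy_opa_line d s) h).
  by rewrite normc_opp normc1 mul1r.
have r0 : r 0 = Q by rewrite /r mul0r addr0.
have := hopa.2 _ (size2 t); rewrite -{1}r0.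
rewrite (hardy_enormE (hflip 0)) (hardy_enormE (hflip t)) lee_fin.
by rewrite nflip nflip.
Qed.

(** If a = 0, then - 1 is orthogonal to f / f(0); but the norm of
    - 1 - t f / f(0) is at least its value at the origin, 1 + t. *)
Lemma opa_lead_neq0 e : cvx_sign e (p / 2) -> f 0 != 0 -> a != 0.
Proof.
move=> se f0; apply/eqP => a0.
pose d := (f 0)^-1.
have at0 t : opa_line d t 0 = t%:C - 1.
  by rewrite /opa_line a0 mul0r add0r -mulrA mulVf// mulr1.
apply: (hardy_no_linear_growth p1 se (opa_lineD d) (hardy_opa_line d)
  (hardy_scale d) (fun t => _) (opa_orth d)).
- move=> t; have -> : (fun z => t%:C * (d * f z)) = (fun z => (t%:C * d) * f z).
    by apply/funext => z; rewrite mulrA.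
  exact: hardy_scale.
- apply/le_anti/andP; split.
    have -> : opa_line d 0 = fun=> -1.
      by apply/funext => z; rewrite /opa_line a0 !mul0r addr0 mul0r add0r.
    have h : Hardy p (fun=> -1 : R[i]).
      have -> : (fun=> -1) = (fun z => (0 * z + 0) * f z + -1).
        by apply/funext => z; ring.
      exact: hardy_linear.
    by have := hardy_norm_cst p1 h; rewrite normc_opp normc1.
  have := norm0_le_hardy p1 (hardy_opa_line d 0).
  by rewrite at0 add0r normc_opp normc1.
- move=> t t0; have := norm0_le_hardy p1 (hardy_opa_line d (- t)).
  rewrite at0; have -> : (- t)%:C - 1 = (- (t + 1))%:C :> R[i].
    by rewrite !rmorphN rmorphD rmorph1 opprD.
  by rewrite normc_real normrN gtr0_norm ?addr_gt0// addrC.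
Qed.

End Opa.
End Final.

Theorem proposition4p3 (R : realType) (p : R) (f : R[i] -> R[i])
  (Q : {poly R[i]}) (a w : R[i])
  (hp : 1 < p) (hf : Hardy p f) (hf0 : f 0 != 0)
  (hQ : Q = a *: ('X - w%:P)) (hopa : is_opa 1 p f Q) :
  let K1 := pyth_lower p in
  let K2 := pyth_upper p in
  let Nazf := hardy_norm p (fun z => a * z * f z - 1) in
  let NQf := hardy_norm p (fun z => Q.[z] * f z - 1) in
  let Naf := hardy_norm p (fun z => a * f z) in
  (p < 2 ->
     ((Nazf `^ 2 - NQf `^ 2) / (K1 * Naf `^ 2)) `^ (1 / 2) >= Normc.normc w
     /\ Normc.normc w >=
        ((Nazf `^ p - NQf `^ p) / (K2 * Naf `^ p)) `^ (1 / p)) /\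
  (2 < p ->
     ((Nazf `^ 2 - NQf `^ 2) / (K2 * Naf `^ 2)) `^ (1 / 2) <= Normc.normc w
     /\ Normc.normc w <=
        ((Nazf `^ p - NQf `^ p) / (K1 * Naf `^ p)) `^ (1 / p)).
Proof.
move=> K1 K2 Nazf NQf Naf; subst Q.
have p0 : 0 < p by lra.
pose X := opa_line f a w (a * w).
have EX1 : (fun z => a * z * f z - 1) = X 1.
  by apply/funext => z; rewrite /X /opa_line mul1r; ring.
have EX0 : (fun z => (a *: ('X - w%:P)).[z] * f z - 1) = X 0.
  by apply/funext => z; rewrite /X /opa_line mul0r addr0 horner_Q.
have main e : cvx_sign e (p / 2) -> [/\ 0 < Naf, NQf <= Nazf,
    0 <= e * (Nazf `^ p - NQf `^ p - (2 `^ (p - 1) - 1)^-1 * (normc w * Naf) `^ p) &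
    0 <= - e * (Nazf ^+ 2 - NQf ^+ 2 - (p - 1) * (normc w * Naf) ^+ 2)].
  move=> se; have a0 := opa_lead_neq0 hp hf hopa se hf0.
  have haf := hardy_scale hp hf a.
  have hy := hardy_scale hp hf (a * w).
  have hty t : Hardy p (fun z => t%:C * (a * w * f z)).
    have -> : (fun z => t%:C * (a * w * f z)) = (fun z => (t%:C * (a * w)) * f z).
      by apply/funext => z; rewrite mulrA.
    exact: hardy_scale.
  have Ny : hardy_norm p (fun z => a * w * f z) = normc w * Naf.
    have E : (fun z => a * w * f z) = (fun z => w * (a * f z)).
      by apply/funext => z; ring.
    have hwy : Hardy p (fun z => w * (a * f z)) by rewrite -E.
    by rewrite E; exact: (hardy_norm_scale hp haf hwy).
  have orth := opa_orth hp hf hopa (a * w).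
  have P := hardy_pythagoras_pow hp se (opa_lineD f a w (a * w))
    (hardy_opa_line a w hp hf (a * w)) hy hty orth.
  have S := hardy_pythagoras_sqr hp se (opa_lineD f a w (a * w))
    (hardy_opa_line a w hp hf (a * w)) hy hty orth.
  rewrite /Nazf /NQf EX1 EX0 -Ny; split=> //.
  by apply: lt_le_trans (norm0_le_hardy hp haf); rewrite normc_gt0 mulf_neq0.
have Nazf0 : 0 <= Nazf by exact: hardy_norm_ge0.
have NQf0 : 0 <= NQf by exact: hardy_norm_ge0.
have two : 0 < 2 `^ (p - 1) - 1 :> R.
  rewrite subr_gt0 -[ltLHS](powRr0 2) /powR pnatr_eq0/= ltr_expR ltr_pM2r.
    lra.
  by rewrite ln_gt0// ltr1n.
clearbody Nazf NQf Naf; clear EX1 EX0 X.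
have w0 := normc_ge0 w; move: (normc w) w0 main => m m0 main.
split=> [p2|p2].
- have se : cvx_sign (-1) (p / 2) by right; split=> //; lra.
  have [A0 AQ] := main _ se.
  rewrite mulN1r opprK mul1r => P S.
  rewrite (powRM _ m0 (ltW A0)) in P; rewrite exprMn in S.
  have K1E : K1 = p - 1 by rewrite /K1 /pyth_lower p2.
  have K2E : K2 = (2 `^ (p - 1) - 1)^-1 by rewrite /K2 /pyth_upper p2.
  rewrite K1E K2E; split.
  + apply: le_powR_root => //.
      by rewrite mulr_gt0 ?powR_gt0// subr_gt0.
    by rewrite !powR_mulrn ?(ltW A0)//; lra.
  + apply: powR_root_le => //.
    * by rewrite mulr_gt0 ?powR_gt0// invr_gt0.
    * by rewrite subr_ge0; apply: (ler_powR_base hp).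
    * lra.
- have se : cvx_sign 1 (p / 2) by left; split=> //; lra.
  have [A0 AQ] := main _ se.
  rewrite mul1r mulN1r => P S.
  rewrite (powRM _ m0 (ltW A0)) in P; rewrite exprMn in S.
  have np2 : (p < 2) = false by apply/negbTE; rewrite -leNgt ltW.
  have K2E : K2 = p - 1 by rewrite /K2 /pyth_upper np2.
  have K1E : K1 = (2 `^ (p - 1) - 1)^-1 by rewrite /K1 /pyth_lower np2.
  rewrite K1E K2E; split.
  + apply: powR_root_le => //.
    * by rewrite mulr_gt0 ?powR_gt0// subr_gt0.
    * rewrite subr_ge0 !powR_mulrn//.
      by rewrite ler_pXn2r ?nnegrE.
    * by rewrite !powR_mulrn ?(ltW A0)//; lra.
  + apply: le_powR_root => //.
      by rewrite mulr_gt0 ?powR_gt0// invr_gt0.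
    lra.
Qed.
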